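(* The quantum Borcherds–Bozec superalgebra $U=U_q(\mathfrak g)$ has a triangular decomposition $U_q(\mathfrak g)\cong U^-\otimes U^0\otimes U^+$; that is, the multiplication map $U^-\otimes U^0\otimes U^+\to U_q(\mathfrak g)$, $x\otimes y\otimes z\mapsto xyz$, is an isomorphism of $\mathbb{Q}(q)$-vector spaces.
   Context: Datum: $I$ is a finite or countably infinite index set, $A=(a_{ij})_{i,j\in I}$ an integer matrix with $a_{ii}\in\{2,0,-2,-4,\dots\}$, $a_{ij}\le0$ for $i\ne j$, and positive integers $d_i$ with $d_ia_{ij}=d_ja_{ji}$; $P$ is a free abelian group, $P^\vee=\mathrm{Hom}(P,\mathbb{Z})$, with linearly independent simple roots $\alpha_i\in P$ and coroots $h_i\in P^\vee$, $\langle h_i,\alpha_j\rangle=a_{ij}$, and elements $\Lambda_i\in P$ with $\langle h_j,\Lambda_i\rangle=\delta_{ij}$; $I=I_{\bar0}\sqcup I_{\bar1}$ with $a_{ij}\in2\mathbb{Z}$ for $i\in I_{\bar1}$, $j\in I$. $p(i)=0$ on $I_{\bar0}$, $1$ on $I_{\bar1}$; $p(li)\in\{0,1\}$, $p(li)\equiv l\,p(i)\pmod2$. $I^{\mathrm{re}}=\{a_{ii}=2\}$, $I^{\mathrm{im}}=\{a_{ii}\le0\}$, $I^\infty=(I^{\mathrm{re}}\times\{1\})\sqcup(I^{\mathrm{im}}\times\mathbb{Z}_{>0})$, $i$ stands for $(i,1)$. $q_i=q^{d_i}$. For $i\in I^{\mathrm{re}}$: $[s]_i=\frac{((-1)^{p(i)}q_i)^s-q_i^{-s}}{(-1)^{p(i)}q_i-q_i^{-1}}$,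 $[n]_i^!=\prod_{s=1}^n[s]_i$, $\begin{bmatrix}n\\t\end{bmatrix}_i=\frac{[n]_i^!}{[t]_i^![n-t]_i^!}$. $U=U_q(\mathfrak g)$ is the associative $\mathbb{Q}(q)$-superalgebra generated by $a_{il},b_{il}$ ($(i,l)\in I^\infty$) of parity $p(li)$ and even $q^h$ ($h\in P^\vee$), with relations $q^0=1$, $q^hq^{h'}=q^{h+h'}$, $q^ha_{il}q^{-h}=q^{l\langle h,\alpha_i\rangle}a_{il}$, $q^hb_{il}q^{-h}=q^{-l\langle h,\alpha_i\rangle}b_{il}$; $\sum_{t+t'=1-ka_{ij}}(-1)^{t'}(-1)^{p(i)(t'p(kj)+\binom{t'}2)}\begin{bmatrix}1-ka_{ij}\\t'\end{bmatrix}_ia_i^ta_{jk}a_i^{t'}=0$ for $i\in I^{\mathrm{re}}$, $(i,1)\ne(j,k)\in I^\infty$, and the same with $b$'s in place of $a$'s; $a_{il}a_{jk}-(-1)^{p(li)p(kj)}a_{jk}a_{il}=b_{il}b_{jk}-(-1)^{p(li)p(kj)}b_{jk}b_{il}=0$ if $a_{ij}=0$; $a_{il}b_{jk}-(-1)^{p(li)p(kj)}b_{jk}a_{il}=\delta_{ij}\delta_{kl}\frac{K_i^l-K_i^{-l}}{1-(-1)^{p(li)}q_i^{2l}}$, where $K_i^l=q^{ld_ih_i}$. $U^+$, $U^-$, $U^0$ are the subalgebras of $U$ generated by the $a_{il}$, the $b_{il}$, and the $q^h$, respectively. *)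

(* Defs.v *)
From HB Require Import structures.
From mathcomp Require Import all_boot all_order all_algebra.
From mathcomp Require Import generic_quotient ring_quotient.
From mathcomp Require Import boolp.
From mathcomp Require Import monalg.

Set Implicit Arguments.
Unset Strict Implicit.
Unset Printing Implicit Defensive.

Import Order.TTheory GRing.Theory Num.Theory.

Local Open Scope ring_scope.
Local Open Scope quotient_scope.

Section Span.
Variables (K : nzRingType) (V : lmodType K).

Inductive lspan (S : V -> Prop) : V -> Prop :=
| lspan_zero : lspan S 0
| lspan_mem x : S x -> lspan S x
| lspan_add x y : lspan S x -> lspan S y -> lspan S (x + y)
| lspan_scale (c : K) x : lspan S x -> lspan S (c *: x).

Definition lspanb (S : V -> Prop) : {pred V} := fun x => `[< lspan S x >].

Lemma lspanP S x : reflect (lspan S x) (x \in lspanb S).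
Proof. exact: asboolP. Qed.

Fact lspanb_closed S : subsemimod_closed (lspanb S).
Proof.
split; first split.
- exact/lspanP/lspan_zero.
- by move=> x y /lspanP Sx /lspanP Sy; apply/lspanP/lspan_add.
- by move=> c x /lspanP Sx; apply/lspanP/lspan_scale.
Qed.

HB.instance Definition _ S :=
  GRing.isSubmodClosed.Build K V (lspanb S) (lspanb_closed S).

End Span.

Section QuotientModule.
Variables (K : nzRingType) (V : lmodType K) (S : V -> Prop).

Definition quot_mod : Type := Quotient.quot (lspanb S).

HB.instance Definition _ := GRing.Zmodule.on quot_mod.

Definition quot_pi (x : V) : quot_mod := \pi_(Quotient.quot (lspanb S)) x.
Definition quot_repr (x : quot_mod) : V := repr (x : Quotient.quot (lspanb S)).

Lemma quot_reprK : cancel quot_repr quot_pi.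
Proof. by move=> x; rewrite /quot_pi /quot_repr reprK. Qed.

Lemma quot_piE x y : (quot_pi x = quot_pi y) <-> (x - y \in lspanb S).
Proof.
by rewrite (Quotient.idealrBE (lspanb S)); split=> [/eqP|/eqP].
Qed.

Lemma quot_pi_is_additive : zmod_morphism quot_pi.
Proof. by move=> x y; rewrite /quot_pi !piE. Qed.

HB.instance Definition _ :=
  GRing.isZmodMorphism.Build V quot_mod quot_pi quot_pi_is_additive.

Definition quot_scale (c : K) (x : quot_mod) := quot_pi (c *: quot_repr x).

Lemma quot_scaleE c x : quot_scale c (quot_pi x) = quot_pi (c *: x).
Proof.
by apply/quot_piE; rewrite -scalerBr rpredZ //; apply/quot_piE/quot_reprK.
Qed.

Fact quot_scaleA c d x : quot_scale c (quot_scale d x) = quot_scale (c * d) x.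
Proof. by rewrite -[x]quot_reprK !quot_scaleE scalerA. Qed.
Fact quot_scale1 : left_id 1 quot_scale.
Proof. by move=> x; rewrite -[x]quot_reprK quot_scaleE scale1r. Qed.
Fact quot_scaleDr : right_distributive quot_scale +%R.
Proof.
move=> c x y; rewrite -[x]quot_reprK -[y]quot_reprK -raddfD !quot_scaleE.
by rewrite scalerDr raddfD.
Qed.
Fact quot_scaleDl x : {morph quot_scale^~ x : c d / c + d}.
Proof.
by move=> c d /=; rewrite -[x]quot_reprK !quot_scaleE scalerDl raddfD.
Qed.

HB.instance Definition _ := GRing.Zmodule_isLmodule.Build K quot_mod
  quot_scaleA quot_scale1 quot_scaleDr quot_scaleDl.

Fact quot_pi_is_scalable : scalable quot_pi.
Proof. by move=> c x; rewrite -quot_scaleE. Qed.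

HB.instance Definition _ :=
  GRing.isScalable.Build K V quot_mod *:%R quot_pi quot_pi_is_scalable.

End QuotientModule.

Section Tensor.
Variables (K : comNzRingType) (V W : lmodType K).

Local Notation F := {malg K[(V * W)%type]}.
Local Notation e v w := (<< (v, w) >> : F).

Inductive tensor_rel : F -> Prop :=
| tensor_addl v v' w : tensor_rel (e (v + v') w - e v w - e v' w)
| tensor_addr v w w' : tensor_rel (e v (w + w') - e v w - e v w')
| tensor_scalel c v w : tensor_rel (e (c *: v) w - c *: e v w)
| tensor_scaler c v w : tensor_rel (e v (c *: w) - c *: e v w).

Definition tensor : Type := quot_mod tensor_rel.
HB.instance Definition _ := GRing.Lmodule.on tensor.

Definition tens (v : V) (w : W) : tensor := quot_pi tensor_rel (e v w).

End Tensor.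

Declare Scope tensor_scope.
Delimit Scope tensor_scope with tensor.
Notation "V ⊗ W" := (tensor V W) (at level 40, left associativity) : type_scope.
Notation "v ⊗ w" := (tens v w) (at level 40, left associativity) : tensor_scope.

Section Subalgebra.
Variables (K : nzRingType) (A : algType K).

Inductive gen_subalg (S : A -> Prop) : A -> Prop :=
| gen_subalg_mem x : S x -> gen_subalg S x
| gen_subalg_one : gen_subalg S 1
| gen_subalg_add x y : gen_subalg S x -> gen_subalg S y -> gen_subalg S (x + y)
| gen_subalg_scale (c : K) x : gen_subalg S x -> gen_subalg S (c *: x)
| gen_subalg_mul x y : gen_subalg S x -> gen_subalg S y -> gen_subalg S (x * y).

Definition gen_subalgb (S : A -> Prop) : {pred A} :=
  fun x => `[< gen_subalg S x >].

Lemma gen_subalgP S x : reflect (gen_subalg S x) (x \in gen_subalgb S).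
Proof. exact: asboolP. Qed.

Fact gen_subalgb_closed S : GRing.subsemialg_closed (gen_subalgb S).
Proof.
split.
- exact/gen_subalgP/gen_subalg_one.
- split; first by apply/gen_subalgP; rewrite -(scale0r 1); do 2!constructor.
  by move=> x y /gen_subalgP Sx /gen_subalgP Sy; apply/gen_subalgP/gen_subalg_add.
- by move=> c x /gen_subalgP Sx; apply/gen_subalgP/gen_subalg_scale.
- by move=> x y /gen_subalgP Sx /gen_subalgP Sy; apply/gen_subalgP/gen_subalg_mul.
Qed.

HB.instance Definition _ S :=
  GRing.isSubalgClosed.Build K A (gen_subalgb S) (gen_subalgb_closed S).

Definition subalgebra (S : A -> Prop) : Type := {x : A | x \in gen_subalgb S}.

HB.instance Definition _ S := SubChoice.on (subalgebra S).
HB.instance Definition _ S := [SubChoice_isSubAlgebra of subalgebra S by <:].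

End Subalgebra.

Section QuotientAlgebra.
Variables (K : nzRingType) (A : algType K).

(* The two-sided ideal generated by [R] is the linear span of [two_sided R]. *)
Definition two_sided (R : A -> Prop) : A -> Prop :=
  fun x => exists u r v, R r /\ x = u * r * v.

(* Algebras are nontrivial in MathComp, whence the second field. *)
Record relations := Relations {
  relator :> A -> Prop;
  relator_proper : 1 \notin lspanb (two_sided relator)
}.

Variable R : relations.
Local Notation I := (two_sided R).

Lemma ideal_mull a x : x \in lspanb I -> a * x \in lspanb I.
Proof.
move=> /lspanP Ix; apply/lspanP; elim: Ix => {x}.
- by rewrite mulr0; apply: lspan_zero.
- move=> _ [u [r [v [Rr ->]]]]; apply: lspan_mem.
  by exists (a * u), r, v; rewrite !mulrA.
- by move=> x y _ Ix _ Iy; rewrite mulrDr; apply: lspan_add.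
- by move=> c x _ Ix; rewrite -scalerAr; apply: lspan_scale.
Qed.

Lemma ideal_mulr a x : x \in lspanb I -> x * a \in lspanb I.
Proof.
move=> /lspanP Ix; apply/lspanP; elim: Ix => {x}.
- by rewrite mul0r; apply: lspan_zero.
- move=> _ [u [r [v [Rr ->]]]]; apply: lspan_mem.
  by exists u, r, (v * a); rewrite !mulrA.
- by move=> x y _ Ix _ Iy; rewrite mulrDl; apply: lspan_add.
- by move=> c x _ Ix; rewrite -scalerAl; apply: lspan_scale.
Qed.

Definition quot_alg : Type := quot_mod I.
HB.instance Definition _ := GRing.Lmodule.on quot_alg.

Definition quot_one : quot_alg := quot_pi I 1.
Definition quot_mul (x y : quot_alg) : quot_alg :=
  quot_pi I (quot_repr x * quot_repr y).

Lemma quot_mulE x y : quot_mul (quot_pi I x) (quot_pi I y) = quot_pi I (x * y).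
Proof.
apply/quot_piE; set x' := quot_repr _; set y' := quot_repr _.
have Ix : x' - x \in lspanb I by apply/quot_piE; rewrite /x' quot_reprK.
have Iy : y' - y \in lspanb I by apply/quot_piE; rewrite /y' quot_reprK.
have -> : x' * y' - x * y = (x' - x) * y' + x * (y' - y).
  by rewrite mulrBl mulrBr addrA subrK.
by rewrite rpredD //; [apply: ideal_mulr | apply: ideal_mull].
Qed.

Local Notation reprE := (fun x => esym (@quot_reprK K A _ x)).

Fact quot_mulA : associative quot_mul.
Proof.
by move=> x y z; rewrite (reprE x) (reprE y) (reprE z) !quot_mulE mulrA.
Qed.
Fact quot_mul1l : left_id quot_one quot_mul.
Proof. by move=> x; rewrite (reprE x) quot_mulE mul1r. Qed.
Fact quot_mul1r : right_id quot_one quot_mul.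
Proof. by move=> x; rewrite (reprE x) quot_mulE mulr1. Qed.
Fact quot_mulDl : left_distributive quot_mul +%R.
Proof.
move=> x y z; rewrite (reprE x) (reprE y) (reprE z).
by rewrite -raddfD !quot_mulE mulrDl raddfD.
Qed.
Fact quot_mulDr : right_distributive quot_mul +%R.
Proof.
move=> x y z; rewrite (reprE x) (reprE y) (reprE z).
by rewrite -raddfD !quot_mulE mulrDr raddfD.
Qed.
Fact quot_one_neq0 : quot_one != 0.
Proof.
apply/eqP; rewrite /quot_one -(raddf0 (quot_pi I)) => /quot_piE.
by rewrite subr0; apply/negP/relator_proper.
Qed.

HB.instance Definition _ := GRing.Zmodule_isNzRing.Build quot_alg
  quot_mulA quot_mul1l quot_mul1r quot_mulDl quot_mulDr quot_one_neq0.

Lemma quot_piM : {morph (quot_pi I : A -> quot_alg) : x y / x * y}.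
Proof. by move=> x y; rewrite -quot_mulE. Qed.
Lemma quot_piZ c : {morph (quot_pi I : A -> quot_alg) : x / c *: x}.
Proof. by move=> x; rewrite -quot_scaleE. Qed.

Fact quot_scaleAl (c : K) (x y : quot_alg) : c *: (x * y) = (c *: x) * y.
Proof.
by rewrite (reprE x) (reprE y) -quot_piM -!quot_piZ -quot_piM scalerAl.
Qed.
HB.instance Definition _ :=
  GRing.Lmodule_isLalgebra.Build K quot_alg quot_scaleAl.
Fact quot_scaleAr (c : K) (x y : quot_alg) : c *: (x * y) = x * (c *: y).
Proof.
by rewrite (reprE x) (reprE y) -quot_piM -!quot_piZ -quot_piM scalerAr.
Qed.
HB.instance Definition _ :=
  GRing.Lalgebra_isAlgebra.Build K quot_alg quot_scaleAr.

Definition quot_alg_pi (x : A) : quot_alg := quot_pi I x.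

Fact quot_alg_pi_is_linear : linear quot_alg_pi.
Proof. exact: linearP. Qed.
HB.instance Definition _ :=
  GRing.isLinear.Build K A quot_alg *:%R quot_alg_pi quot_alg_pi_is_linear.
Fact quot_alg_pi_is_monoid_morphism : monoid_morphism quot_alg_pi.
Proof. by split=> // x y; exact: quot_piM. Qed.
HB.instance Definition _ := GRing.isMonoidMorphism.Build A quot_alg quot_alg_pi
  quot_alg_pi_is_monoid_morphism.

End QuotientAlgebra.

Section FreeAlgebra.
Variables (K : comNzRingType) (X : choiceType).

Definition free_alg : Type := {malg K[{fmonom X}]}.
HB.instance Definition _ := GRing.Lalgebra.on free_alg.

Fact free_alg_scaleAr (c : K) (x y : free_alg) : c *: (x * y) = x * (c *: y).
Proof.
have comm (z : {malg K[{fmonom X}]}) : c%:MP * z = z * c%:MP.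
  rewrite [c%:MP * z]fgmulUg [z * c%:MP]fgmulgU.
  by apply: eq_bigr => m _; rewrite mul1m mulm1 mulrC.
by rewrite /free_alg -!mul_malgC mulrA comm -mulrA.
Qed.
HB.instance Definition _ :=
  GRing.Lalgebra_isAlgebra.Build K free_alg free_alg_scaleAr.

Definition free_gen (x : X) : free_alg := << fmu x >>.

End FreeAlgebra.

Section FreeAlgebraEval.
Variables (K : comNzRingType) (X : choiceType) (f : X -> K).

Definition word_eval (m : {fmonom X}) : K := \prod_(x <- (m : seq X)) f x.

Fact word_eval_mmorphism : mmorphism word_eval.
Proof.
by split=> [m n|]; rewrite /word_eval ?fmM ?big_cat // fm1 big_nil.
Qed.
HB.instance Definition _ :=
  monalg.isMultiplicative.Build {fmonom X} K word_eval word_eval_mmorphism.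

Definition free_eval (x : free_alg K X) : K := mmap idfun word_eval x.

Fact free_eval_is_linear : linear_for *%R free_eval.
Proof.
move=> c x y; rewrite /free_eval.
by rewrite (linearP (mmap idfun word_eval : {malg K[{fmonom X}]} -> K)).
Qed.
HB.instance Definition _ := GRing.isLinear.Build K (free_alg K X) K *%R free_eval
  free_eval_is_linear.
Fact free_eval_is_monoid_morphism : monoid_morphism free_eval.
Proof.
split=> [|x y]; first exact: (rmorph1 (mmap idfun word_eval)).
exact: (rmorphM (mmap idfun word_eval)).
Qed.
HB.instance Definition _ := GRing.isMonoidMorphism.Build (free_alg K X) K
  free_eval free_eval_is_monoid_morphism.

Lemma free_eval_gen x : free_eval (free_gen K x) = f x.
Proof. by rewrite /free_eval mmapU /= mul1r /word_eval fmU big_seq1. Qed.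

Lemma free_eval_proper (R : free_alg K X -> Prop) :
  (forall r, R r -> free_eval r = 0) -> 1 \notin lspanb (two_sided R).
Proof.
move=> R0; apply/negP => /lspanP R1.
suff: free_eval 1 = 0 by apply/eqP; rewrite rmorph1 oner_eq0.
elim: R1 => [|_ [u [r [v [/R0 r0 ->]]]]|x y _ x0 _ y0|c x _ x0].
- exact: raddf0.
- by rewrite !rmorphM /= r0 mulr0 mul0r.
- by rewrite raddfD /= x0 y0 addr0.
- by rewrite linearZ /= x0 mulr0.
Qed.

End FreeAlgebraEval.

Section Dual.
Variable P : zmodType.

Definition dual : Type := {additive P -> int}.
HB.instance Definition _ := gen_eqMixin dual.
HB.instance Definition _ := gen_choiceMixin dual.

Definition pairing (h : dual) (x : P) : int := (h : {additive P -> int}) x.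

Lemma dualP (g h : dual) : pairing g =1 pairing h -> g = h.
Proof.
case: g h => [g [[gP]]] [h [[hP]]] gh.
have {}gh : g = h by apply/funext.
by move: gP; rewrite gh => gP; rewrite (Prop_irrelevance gP hP).
Qed.

Definition dual_zero : dual := \0 : {additive P -> int}.
Definition dual_add (g h : dual) : dual :=
  (g : {additive P -> int}) \+ (h : {additive P -> int}) : {additive P -> int}.
Definition dual_opp (h : dual) : dual :=
  \- (h : {additive P -> int}) : {additive P -> int}.

Fact dual_addA : associative dual_add.
Proof. by move=> f g h; apply/dualP => x; apply: addrA. Qed.
Fact dual_addC : commutative dual_add.
Proof. by move=> f g; apply/dualP => x; apply: addrC. Qed.
Fact dual_add0 : left_id dual_zero dual_add.
Proof. by move=> f; apply/dualP => x; apply: add0r. Qed.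
Fact dual_addN : left_inverse dual_zero dual_opp dual_add.
Proof. by move=> f; apply/dualP => x; apply: addNr. Qed.

HB.instance Definition _ :=
  GRing.isZmodule.Build dual dual_addA dual_addC dual_add0 dual_addN.

End Dual.

Notation "⟨ h , x ⟩" := (pairing h x) (at level 0, h at level 99).

Definition free_abelian (P : zmodType) : Prop :=
  exists (B : choiceType) (f : {additive {malg int[B]} -> P}), bijective f.

Definition Z_independent (I : choiceType) (P : zmodType) (v : I -> P) : Prop :=
  forall (s : seq I) (c : I -> int), uniq s ->
    \sum_(i <- s) v i *~ c i = 0 -> {in s, forall i, c i = 0}.

(* I, (a_ij), (d_i) and P are [vertex], [cartan], [dsym] and [lattice]; the odd
   part of I is [odd_vertex]. Linear independence of the coroots follows from
   [pairing_Lambda]. *)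
Record superdatum := Superdatum {
  vertex : countType;
  cartan : vertex -> vertex -> int;
  dsym : vertex -> nat;
  odd_vertex : pred vertex;
  lattice : zmodType;
  alpha : vertex -> lattice;
  coroot : vertex -> dual lattice;
  Lambda : vertex -> lattice;
  cartan_diag : forall i, cartan i i = 2 \/ exists n : nat, cartan i i = - (n.*2)%:Z;
  cartan_off_diag : forall i j, i != j -> cartan i j <= 0;
  dsym_gt0 : forall i, (0 < dsym i)%N;
  cartan_symmetrizable : forall i j,
    (dsym i)%:Z * cartan i j = (dsym j)%:Z * cartan j i;
  cartan_odd : forall i j, odd_vertex i -> (2 %| cartan i j)%Z;
  lattice_free : free_abelian lattice;
  alpha_independent : Z_independent alpha;
  pairing_alpha : forall i j, ⟨coroot i, alpha j⟩ = cartan i j;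
  pairing_Lambda : forall i j, ⟨coroot j, Lambda i⟩ = (i == j)%:R
}.

Section BorcherdsBozec.
Variable D : superdatum.

Definition real_vertex (i : vertex D) : bool := cartan i i == 2.
Definition imag_vertex (i : vertex D) : bool := cartan i i <= 0.

Definition Iinf : Type :=
  {x : vertex D * nat |
    real_vertex x.1 && (x.2 == 1) || imag_vertex x.1 && (0 < x.2)}%N.
HB.instance Definition _ := SubChoice.on Iinf.

Definition vert (x : Iinf) : vertex D := (val x).1.
Definition level (x : Iinf) : nat := (val x).2.

Definition parity (i : vertex D) : nat := odd_vertex i.
Definition level_parity (x : Iinf) : nat := ((level x * parity (vert x)) %% 2)%N.

Definition Qq : fieldType := {fraction {poly rat}}.
Definition q : Qq := FracField.tofrac ('X : {poly rat}).
Definition q_ (i : vertex D) : Qq := q ^+ dsym i.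

Definition qint (i : vertex D) (s : nat) : Qq :=
  (((-1) ^+ parity i * q_ i) ^+ s - q_ i ^- s)
    / ((-1) ^+ parity i * q_ i - (q_ i)^-1).
Definition qfact (i : vertex D) (n : nat) : Qq := \prod_(1 <= s < n.+1) qint i s.
Definition qbin (i : vertex D) (n t : nat) : Qq :=
  qfact i n / (qfact i t * qfact i (n - t)).

Definition gen : choiceType := (Iinf + Iinf + dual (lattice D))%type.

Local Notation F := (free_alg Qq gen).

Definition gen_a (x : Iinf) : F := free_gen Qq (inl (inl x) : gen).
Definition gen_b (x : Iinf) : F := free_gen Qq (inl (inr x) : gen).
Definition gen_q (h : dual (lattice D)) : F := free_gen Qq (inr h : gen).

Definition gen_K (i : vertex D) (l : int) : F :=
  gen_q (coroot i *~ (l * (dsym i)%:Z)).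

(* When x = (i, 1) with i real and x <> y = (j, k), one has i <> j, hence
   1 - k a_ij >= 1. *)
Definition serre_deg (x y : Iinf) : nat :=
  absz (1 - (level y)%:Z * cartan (vert x) (vert y))%R.

Definition serre (g : Iinf -> F) (x y : Iinf) : F :=
  let i := vert x in let N := serre_deg x y in
  \sum_(t' < N.+1)
    ((-1) ^+ t' * (-1) ^+ (parity i * (t' * level_parity y + 'C(t', 2)))
       * qbin i N t')
      *: (g x ^+ (N - t') * g y * g x ^+ t').

Definition supercomm (x y : Iinf) (u v : F) : F :=
  u * v - (-1) ^+ (level_parity x * level_parity y) *: (v * u).

(* U is built as an associative algebra; its superalgebra structure enters only
   through the signs given by the parities of the generators. *)
Inductive relator_U : F -> Prop :=
| rel_q0 : relator_U (gen_q 0 - 1)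
| rel_qD h h' : relator_U (gen_q (h + h') - gen_q h * gen_q h')
| rel_qa h x : relator_U (gen_q h * gen_a x * gen_q (- h)
    - q ^ ((level x)%:Z * ⟨h, alpha (vert x)⟩) *: gen_a x)
| rel_qb h x : relator_U (gen_q h * gen_b x * gen_q (- h)
    - q ^ (- ((level x)%:Z * ⟨h, alpha (vert x)⟩)) *: gen_b x)
| rel_serre_a x y : real_vertex (vert x) -> x != y -> relator_U (serre gen_a x y)
| rel_serre_b x y : real_vertex (vert x) -> x != y -> relator_U (serre gen_b x y)
| rel_comm_a x y : cartan (vert x) (vert y) = 0 ->
    relator_U (supercomm x y (gen_a x) (gen_a y))
| rel_comm_b x y : cartan (vert x) (vert y) = 0 ->
    relator_U (supercomm x y (gen_b x) (gen_b y))
| rel_ab x y : relator_U (supercomm x y (gen_a x) (gen_b y)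
    - ((x == y)%:R / (1 - (-1) ^+ level_parity x * q_ (vert x) ^+ (2 * level x)))
        *: (gen_K (vert x) (level x)%:Z - gen_K (vert x) (- (level x)%:Z))).

Definition counit_gen (g : gen) : Qq := if g is inr _ then 1 else 0.

Fact relator_U_proper : 1 \notin lspanb (two_sided relator_U).
Proof.
have a0 x : free_eval counit_gen (gen_a x) = 0 by rewrite free_eval_gen.
have b0 x : free_eval counit_gen (gen_b x) = 0 by rewrite free_eval_gen.
have q1 h : free_eval counit_gen (gen_q h) = 1 by rewrite free_eval_gen.
have serre0 g x y : (forall z, free_eval counit_gen (g z) = 0) ->
    free_eval counit_gen (serre g x y) = 0.
  move=> g0; rewrite raddf_sum big1 //= => t _.
  by rewrite linearZ /= !rmorphM /= g0 mulr0 mul0r mulr0.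
have comm0 x y u v : free_eval counit_gen u = 0 ->
    free_eval counit_gen (supercomm x y u v) = 0.
  by move=> u0; rewrite /supercomm raddfB /= linearZ /= !rmorphM /= u0 mul0r !mulr0 subrr.
apply: (@free_eval_proper _ _ counit_gen) => _ [].
- by rewrite raddfB /= rmorph1 q1 subrr.
- by move=> h h'; rewrite raddfB /= rmorphM /= !q1 mulr1 subrr.
- by move=> h x; rewrite raddfB /= linearZ /= !rmorphM /= a0 mulr0 mul0r mulr0 subrr.
- by move=> h x; rewrite raddfB /= linearZ /= !rmorphM /= b0 mulr0 mul0r mulr0 subrr.
- by move=> x y _ _; apply: serre0.
- by move=> x y _ _; apply: serre0.
- by move=> x y _; apply: comm0.
- by move=> x y _; apply: comm0.
- move=> x y; rewrite raddfB /= comm0 // linearZ /= raddfB /= !q1.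
  by rewrite subrr mulr0 subr0.
Qed.

Definition U : algType Qq := quot_alg (Relations relator_U_proper).

Definition Ua (x : Iinf) : U := quot_alg_pi _ (gen_a x).
Definition Ub (x : Iinf) : U := quot_alg_pi _ (gen_b x).
Definition Uq (h : dual (lattice D)) : U := quot_alg_pi _ (gen_q h).

Definition Uplus : algType Qq := subalgebra (fun u => exists x, u = Ua x).
Definition Uminus : algType Qq := subalgebra (fun u => exists x, u = Ub x).
Definition Uzero : algType Qq := subalgebra (fun u => exists h, u = Uq h).

End BorcherdsBozec.

(* Main.v *)
Require Import Defs.
From HB Require Import structures.
From mathcomp Require Import all_boot all_order all_algebra.
From mathcomp Require Import boolp finmap monalg ring.

(** Why multiplication U^- ⊗ U^0 ⊗ U^+ -> U is bijective.

    Drop the Serre relations and the commutation relations among the a's and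
    among the b's.  What remains only reorders generators: q^h passes every
    letter up to a scalar, and a_x passes b_y up to a sign and a torus term.
    In the resulting algebra, here [cross_alg], the words b..b q^h a..a span,
    since generators can be sorted ([span_a]).  They are also linearly
    independent, because the algebra acts on the vector space with basis these
    words, by the operators that sorting dictates; acting on the empty word
    reads off coordinates ([cross_normal_form]).

    Each dropped relator is a polynomial S in the a's alone, or in the b's
    alone, and it commutes, up to a nonzero scalar, with the torus and with all
    letters of the opposite kind ([supercomm_qcomm], [serre_b]).  This is the
    only place where the shape of the Serre relations matters: when b_x or b_y
    is pulled through the Serre element, the torus terms that appear cancel
    because of a recurrence between consecutive super binomials, respectively
    because of an alternating sum that telescopes ([telescope]).

    Now let Phi be the linear map from [cross_alg] to U^- ⊗ U^0 ⊗ U^+ that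
    sends a word b..b q^h a..a to the corresponding pure tensor.  It kills the
    ideal generated by the dropped relators: in u S v with S in the a's, the
    part of v in the b's and the torus moves to the left of S, and after
    sorting what is then on the left, S occurs inside the a-part of a sorted
    word, hence inside U^+, where it is zero ([Phi_ideal]).  So Phi descends to
    U, and on words it is visibly inverse to multiplication.  Because Phi takes
    values in subalgebras of U, presentations of U^- and U^+ never enter. *)

Set Implicit Arguments.
Unset Strict Implicit.
Unset Printing Implicit Defensive.

Import Order.TTheory GRing.Theory Num.Theory.

Local Open Scope ring_scope.

(** * Linear maps out of spans, free modules, quotients and tensor products *)

Section Spans.
Variables (K : nzRingType) (V W : lmodType K).

Lemma lspan_sub (S S' : V -> Prop) x :
  (forall y, S y -> lspan S' y) -> lspan S x -> lspan S' x.
Proof.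
move=> SS'; elim=> {x} [|x /SS'|x y _ Sx _ Sy|c x _ Sx] //.
- exact: lspan_zero.
- exact: lspan_add.
- exact: lspan_scale.
Qed.

Lemma lspan_map (f : {linear V -> W}) (S : V -> Prop) (S' : W -> Prop) x :
  (forall y, S y -> lspan S' (f y)) -> lspan S x -> lspan S' (f x).
Proof.
move=> fS; elim=> {x} [|x /fS|x y _ Sx _ Sy|c x _ Sx] //.
- by rewrite linear0; apply: lspan_zero.
- by rewrite linearD; apply: lspan_add.
- by rewrite linearZ; apply: lspan_scale.
Qed.

Lemma lspan_eq (f g : {linear V -> W}) (S : V -> Prop) x :
  (forall y, S y -> f y = g y) -> lspan S x -> f x = g x.
Proof.
move=> fg; elim=> {x} [|x /fg|x y _ fgx _ fgy|c x _ fgx] //.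
- by rewrite !linear0.
- by rewrite !linearD fgx fgy.
- by rewrite !linearZ fgx.
Qed.

Lemma lspan_ker (f : {linear V -> W}) (S : V -> Prop) x :
  (forall y, S y -> f y = 0) -> lspan S x -> f x = 0.
Proof. exact: (@lspan_eq f \0). Qed.

End Spans.

Lemma lspan_cancel (K : nzRingType) (V W : lmodType K)
    (f : {linear V -> W}) (g : {linear W -> V}) (S : V -> Prop) x :
  (forall y, S y -> g (f y) = y) -> lspan S x -> g (f x) = x.
Proof. exact: (@lspan_eq _ _ _ (g \o f)%FUN idfun). Qed.

Section BasisExtension.
Variables (K : nzRingType) (I : choiceType) (V : lmodType K) (f : I -> V).

Definition malg_ext (g : {malg K[I]}) : V := \sum_(i <- msupp g) g@_i *: f i.

Let malg_extEw (d : {fset I}) g : (msupp g `<=` d)%fset ->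
  malg_ext g = \sum_(i <- d) g@_i *: f i.
Proof.
move=> gd; apply: big_fset_incl => // i _ /mcoeff_outdom ->.
exact: scale0r.
Qed.

Fact malg_ext_is_linear : linear malg_ext.
Proof.
move=> c g h; pose d := (msupp g `|` msupp h `|` msupp (c *: g + h))%fset.
have dg : (msupp g `<=` d)%fset by rewrite /d -fsetUA fsubsetUl.
have dh : (msupp h `<=` d)%fset by rewrite /d -fsetUA fsetUCA fsubsetUl.
rewrite (malg_extEw dg) (malg_extEw dh) (@malg_extEw d) ?fsubsetUr //.
rewrite scaler_sumr -big_split; apply: eq_bigr => i _ /=.
by rewrite mcoeffD mcoeffZ scalerDl scalerA.
Qed.
HB.instance Definition _ :=
  GRing.isLinear.Build K {malg K[I]} V *:%R malg_ext malg_ext_is_linear.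

Lemma malg_extU i : malg_ext << i >> = f i.
Proof. by rewrite (malg_extEw msuppU_le) big_seq_fset1 mcoeffUU scale1r. Qed.

End BasisExtension.

Lemma malg_span (K : nzRingType) (I : choiceType) (g : {malg K[I]}) :
  lspan (fun x => exists i, x = << i >>) g.
Proof.
apply/lspanP; rewrite [g]monalgE rpred_sum // => i _.
have -> : << g@_i *g i >> = g@_i *: (<< i >> : {malg K[I]}).
  by apply/malgP => j; rewrite mcoeffZ !mcoeffU mulr_natr.
by rewrite rpredZ //; apply/lspanP/lspan_mem; exists i.
Qed.

Lemma quot_lift (K : nzRingType) (V W : lmodType K) (S : V -> Prop)
    (f : {linear V -> W}) : (forall x, S x -> f x = 0) ->
  exists g : {linear quot_mod S -> W}, forall x, g (quot_pi S x) = f x.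
Proof.
move=> f0.
have gE x : f (quot_repr (quot_pi S x)) = f x.
  apply/eqP; rewrite -subr_eq0 -raddfB; apply/eqP.
  by apply: lspan_ker f0 _; apply/lspanP/quot_piE; rewrite quot_reprK.
pose g (x : quot_mod S) := f (quot_repr x).
have gL : linear g.
  move=> c x y; rewrite -[x]quot_reprK -[y]quot_reprK.
  by rewrite -linearZ -raddfD /g !gE linearD linearZ.
pose gl := GRing.isLinear.Build K (quot_mod S) W *:%R g gL.
by exists (HB.pack_for {linear quot_mod S -> W} g gl).
Qed.

Section TensorTheory.
Variables (K : comNzRingType) (V W : lmodType K).
Local Open Scope tensor_scope.

Lemma tensDl (v v' : V) (w : W) : (v + v') ⊗ w = v ⊗ w + v' ⊗ w.
Proof.
rewrite /tens -raddfD; apply/quot_piE; rewrite opprD addrA.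
exact/lspanP/lspan_mem/tensor_addl.
Qed.
Lemma tensDr (v : V) (w w' : W) : v ⊗ (w + w') = v ⊗ w + v ⊗ w'.
Proof.
rewrite /tens -raddfD; apply/quot_piE; rewrite opprD addrA.
exact/lspanP/lspan_mem/tensor_addr.
Qed.
Lemma tensZl c (v : V) (w : W) : (c *: v) ⊗ w = c *: (v ⊗ w).
Proof.
rewrite /tens -[RHS]linearZ; apply/quot_piE.
exact/lspanP/lspan_mem/tensor_scalel.
Qed.
Lemma tensZr c (v : V) (w : W) : v ⊗ (c *: w) = c *: (v ⊗ w).
Proof.
rewrite /tens -[RHS]linearZ; apply/quot_piE.
exact/lspanP/lspan_mem/tensor_scaler.
Qed.
Lemma tens0l (w : W) : (0 : V) ⊗ w = 0.
Proof. by rewrite -(scale0r 0) tensZl scale0r. Qed.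
Lemma tens0r (v : V) : v ⊗ (0 : W) = 0.
Proof. by rewrite -(scale0r 0) tensZr scale0r. Qed.

Lemma tens_span (t : (V ⊗ W)%type) : lspan (fun x => exists v w, x = v ⊗ w) t.
Proof.
rewrite -[t]quot_reprK.
apply: (@lspan_map _ _ _ (quot_pi _)) (malg_span _) => _ [[v w] ->].
by apply: lspan_mem; exists v, w.
Qed.

Lemma tens_lift (Z : lmodType K) (f : V -> W -> Z) :
  (forall w, linear (f^~ w)) -> (forall v, linear (f v)) ->
  exists g : {linear (V ⊗ W)%type -> Z}, forall v w, g (v ⊗ w) = f v w.
Proof.
move=> fl fr.
pose fL w : {linear V -> Z} :=
  HB.pack (f^~ w) (GRing.isLinear.Build _ _ _ _ _ (fl w)).
pose fR v : {linear W -> Z} :=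
  HB.pack (f v) (GRing.isLinear.Build _ _ _ _ _ (fr v)).
have fDl v v' w : f (v + v') w = f v w + f v' w by exact: (linearD (fL w)).
have fDr v w w' : f v (w + w') = f v w + f v w' by exact: (linearD (fR v)).
have fZl c v w : f (c *: v) w = c *: f v w by exact: (linearZ_LR (fL w)).
have fZr c v w : f v (c *: w) = c *: f v w by exact: (linearZ_LR (fR v)).
have [|g gE] := @quot_lift _ _ _ (@tensor_rel K V W)
                  (malg_ext (fun vw => f vw.1 vw.2)).
  move=> _ [v v' w|v w w'|c v w|c v w]; rewrite !raddfB /= ?linearZ_LR /=;
    rewrite !malg_extU /=.
  - by apply/eqP; rewrite subr_eq0 subr_eq fDl addrC.
  - by apply/eqP; rewrite subr_eq0 subr_eq fDr addrC.
  - by rewrite fZl scalerN subrr.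
  - by rewrite fZr scalerN subrr.
by exists g => v w; rewrite [LHS]gE; apply: malg_extU.
Qed.

End TensorTheory.

(** * Commutation up to a nonzero scalar *)
Section QuasiCommutation.
Variables (K : fieldType) (A : algType K).
Implicit Types u v g : A.

Definition qcomm u v : Prop := exists2 c : K, c != 0 & u * v = c *: (v * u).

Lemma qcomm_sym u v : qcomm u v -> qcomm v u.
Proof.
case=> c c0 uv; exists c^-1; first by rewrite invr_eq0.
by rewrite uv scalerA mulVf // scale1r.
Qed.

Lemma qcommMr u v v' : qcomm u v -> qcomm u v' -> qcomm u (v * v').
Proof.
move=> [c c0 uv] [d d0 uv']; exists (c * d); first by rewrite mulf_neq0.
by rewrite mulrA uv -scalerAl -[v * u * v']mulrA uv' -scalerAr scalerA mulrA.
Qed.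

Lemma qcomm1 u : qcomm u 1.
Proof. by exists 1; rewrite ?oner_eq0 // mulr1 mul1r scale1r. Qed.

Lemma qcomm_prod (I : Type) (r : seq I) u (F : I -> A) :
  (forall i, qcomm u (F i)) -> qcomm u (\prod_(i <- r) F i).
Proof.
by move=> uF; elim/big_rec: _ => [|i v _]; [apply: qcomm1 | apply: qcommMr].
Qed.

End QuasiCommutation.

(** * Relations that only reorder generators *)

(** A letter stands for a pair (i,l); [weight h x] is the scalar by which
    conjugation with q^h multiplies a_x, [sign] is the super sign of two
    letters, and [kappa x] is the exponent of the torus element K_i^l. *)
Record crossing_datum (K : fieldType) := CrossingDatum {
  letter : choiceType;
  torus : zmodType;
  weight : torus -> letter -> K;
  sign : letter -> letter -> K;
  kappa : letter -> torus;
  weight0 : forall x, weight 0 x = 1;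
  weightD : forall g h x, weight (g + h) x = weight g x * weight h x;
  sign_sym : forall x y, sign x y = sign y x;
  sign_sq : forall x y, sign x y * sign x y = 1
}.

Section Crossing.
Variables (K : fieldType) (D : crossing_datum K).
Local Notation X := (letter D).
Local Notation H := (torus D).
Local Notation wt := (@weight K D).
Local Notation s := (@sign K D).
Local Notation kk := (@kappa K D).

Lemma weight_neq0 h x : wt h x != 0.
Proof.
apply/eqP => h0; have /eqP := weightD h (- h) x.
by rewrite h0 mul0r subrr weight0 oner_eq0.
Qed.

Lemma weightN h x : wt (- h) x = (wt h x)^-1.
Proof.
apply: (mulIf (weight_neq0 h x)).
by rewrite mulVf ?weight_neq0 // -weightD addNr weight0.
Qed.

Lemma sign_neq0 x y : s x y != 0.
Proof.
by apply/eqP => s0; have /eqP := sign_sq x y; rewrite s0 mul0r eq_sym oner_eq0.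
Qed.

Definition words (A : algType K) (b a : X -> A) (k : H -> A) (u : A) : Prop :=
  exists v h w, u = \prod_(x <- v) b x * k h * \prod_(x <- w) a x.

(** The constant [c] is a parameter because it changes when the roles of the
    [a]s and the [b]s are exchanged ([crossing_swap]). *)
Record crossing (c : X -> K) (A : algType K) (a b : X -> A) (k : H -> A) : Prop :=
  Crossing {
    torus_1 : k 0 = 1;
    torus_D : forall g h, k (g + h) = k g * k h;
    torus_a : forall h x, k h * a x = wt h x *: (a x * k h);
    torus_b : forall h x, k h * b x = wt (- h) x *: (b x * k h);
    cross_ab : forall x y, a x * b y = s x y *: (b y * a x)
      + ((x == y)%:R * c x) *: (k (kk x) - k (- kk x))
  }.

(** The relations are symmetric in [a] and [b] once q^h is replaced by q^(-h):
    whatever holds for relators in the [a]s transfers to relators in the [b]s. *)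
Lemma crossing_swap c (A : algType K) (a b : X -> A) k :
  crossing c a b k -> crossing (fun x => s x x * c x) b a (fun h => k (- h)).
Proof.
move=> [k1 kD ka kb ab]; split.
- by rewrite oppr0.
- by move=> g h; rewrite opprD kD.
- by move=> h x; rewrite kb opprK.
- by move=> h x; rewrite ka.
move=> x y; rewrite ab scalerDr scalerA sign_sym sign_sq scale1r -addrA.
rewrite -[LHS]addr0; congr (_ + _).
have [<-|] := eqVneq y x; last by rewrite !mul0r !scale0r scaler0 addr0.
by rewrite !mul1r opprK -[X in _ + _ *: X]opprB scalerN scalerA subrr.
Qed.

Section Algebra.
Variables (c : X -> K) (A : algType K) (a b : X -> A) (k : H -> A).
Hypothesis rels : crossing c a b k.
Let k1 := torus_1 rels.
Let kD := torus_D rels.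
Let ka := torus_a rels.
Let kb := torus_b rels.
Let ab := cross_ab rels.

Local Notation span := (lspan (words b a k)).

Lemma torus_words h v :
  exists e : K, k h * \prod_(x <- v) b x = e *: (\prod_(x <- v) b x * k h).
Proof.
elim: v => [|x v [e IH]]; first by exists 1; rewrite big_nil mulr1 mul1r scale1r.
exists (wt (- h) x * e); rewrite big_cons mulrA kb -scalerAl -[_ * k h * _]mulrA.
by rewrite IH -scalerAr scalerA mulrA.
Qed.

Lemma span_1 : span 1.
Proof. by apply: lspan_mem; exists [::], 0, [::]; rewrite !big_nil k1 !mulr1. Qed.

Lemma span_b x u : span u -> span (b x * u).
Proof.
apply: (@lspan_map _ _ _ (b x \*o idfun)) => _ [v [h [w ->]]] /=.
by apply: lspan_mem; exists (x :: v), h, w; rewrite big_cons /= !mulrA.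
Qed.

Lemma span_k h u : span u -> span (k h * u).
Proof.
apply: (@lspan_map _ _ _ (k h \*o idfun)) => _ [v [g [w ->]]] /=.
have [e hv] := torus_words h v.
rewrite !mulrA hv -!scalerAl; apply: lspan_scale; apply: lspan_mem.
by exists v, (h + g), w; rewrite kD !mulrA.
Qed.

(** Each crossing of [a x] with a letter of the [b]-word leaves a torus term in
    front of a shorter [b]-word, whence the induction on that word. *)
Lemma span_a x u : span u -> span (a x * u).
Proof.
apply: (@lspan_map _ _ _ (a x \*o idfun)) => _ [v [h [w ->]]] /=.
rewrite -mulrA; elim: v => [|y v IH].
  rewrite big_nil mul1r.
  have -> : a x * (k h * \prod_(x <- w) a x)
      = (wt h x)^-1 *: (1 * k h * \prod_(x <- x :: w) a x).
    by rewrite big_cons mul1r !mulrA ka -scalerAl scalerA mulVf ?weight_neq0 ?scale1r.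
  apply/lspan_scale/lspan_mem; exists [::], h, (x :: w).
  by rewrite [\prod_(x <- [::]) _]big_nil.
rewrite big_cons -[b y * _ * _]mulrA [a x * _]mulrA ab mulrDl -!scalerAl.
have Sv : span (\prod_(x <- v) b x * (k h * \prod_(x <- w) a x)).
  by apply: lspan_mem; exists v, h, w; rewrite mulrA.
rewrite -[b y * _ * _]mulrA; apply: lspan_add; apply: lspan_scale.
  exact: span_b.
rewrite mulrBl -scaleN1r; apply: lspan_add; last apply: lspan_scale; exact: span_k.
Qed.

Lemma supercomm_torus x y h :
  qcomm (a x * a y - s x y *: (a y * a x)) (k h).
Proof.
apply/qcomm_sym; exists (wt h x * wt h y); first by rewrite mulf_neq0 ?weight_neq0.
have E x' y' : k h * (a x' * a y') = (wt h x' * wt h y') *: (a x' * a y' * k h).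
  by rewrite mulrA ka -scalerAl -[a x' * k h * _]mulrA ka -scalerAr scalerA mulrA.
rewrite mulrBr E -scalerAr E [wt h y * _]mulrC mulrBl -scalerAl scalerBr !scalerA.
by rewrite [s x y * _]mulrC.
Qed.

Let kap x := k (kk x) - k (- kk x).

(** Pulling [b z] to the left creates torus terms if [z] is [x] or [y].  The
    weight hypotheses make these commute with the remaining letter, and then
    they cancel in pairs because [s] is symmetric with square 1. *)
Lemma supercomm_qcomm x y : wt (kk x) y = 1 -> wt (kk y) x = 1 ->
  forall z, qcomm (a x * a y - s x y *: (a y * a x)) (b z).
Proof.
move=> xy yx z; exists (s x z * s y z); first by rewrite mulf_neq0 ?sign_neq0.
have comm x' y' : wt (kk x') y' = 1 -> kap x' * a y' = a y' * kap x'.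
  by move=> w1; rewrite mulrBl mulrBr !ka weightN w1 invr1 !scale1r.
pose d x' := (x' == z)%:R * c x'.
have abz x' : a x' * b z = s x' z *: (b z * a x') + d x' *: kap x' by exact: ab.
have E x' y' : a x' * a y' * b z = (s x' z * s y' z) *: (b z * (a x' * a y'))
    + ((s y' z * d x') *: (kap x' * a y') + d y' *: (a x' * kap y')).
  rewrite -mulrA abz mulrDr -!scalerAr [a x' * (b z * _)]mulrA abz mulrDl.
  by rewrite -!scalerAl scalerDr !scalerA -addrA !mulrA [s y' z * s x' z]mulrC.
rewrite mulrBl -scalerAl !E (mulrBr (b z)) -(scalerAr (s x y)).
rewrite (scalerDr (s x y)) opprD addrACA -[RHS]addr0; congr (_ + _).
  by rewrite scalerBr !scalerA [s y z * s x z]mulrC [s x y * _]mulrC.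
rewrite (comm x y xy) (comm y x yx) (scalerDr (s x y)) !scalerA opprD.
rewrite [- _ - _]addrC addrACA -!scalerBl.
have -> : s y z * d x - s x y * d x = 0.
  rewrite /d; have [<-|] := eqVneq x z; last by rewrite !mul0r !mulr0 subrr.
  by rewrite [s y x]sign_sym subrr.
have -> : d y - s x y * (s x z * d y) = 0; last by rewrite !scale0r addr0.
rewrite /d; have [<-|] := eqVneq y z; last by rewrite !mul0r !mulr0 subrr.
by rewrite mulrA sign_sq !mul1r subrr.
Qed.

(** * Serre elements commute with the opposite letters *)
Section Serre.
Variables (x y : X) (N : nat) (cf : nat -> K).
Local Notation p := (s x x).
Local Notation Q := (wt (kk x) x).
Local Notation Y := (wt (kk x) y).
Local Notation Z := (wt (kk y) x).

Definition geom_sum (r : K) (n : nat) : K := \sum_(m < n) r ^+ m.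

Lemma geom_sum0 r : geom_sum r 0 = 0.
Proof. by rewrite /geom_sum big_ord0. Qed.

Lemma geom_sumS r n : geom_sum r n.+1 = r * geom_sum r n + 1.
Proof.
rewrite /geom_sum big_ord_recl addrC mulr_sumr; congr (_ + _).
by apply: eq_bigr => i _; rewrite -exprS.
Qed.

Definition serre_sum : A :=
  \sum_(t < N.+1) cf t *: (a x ^+ (N - t) * a y * a x ^+ t).

Lemma torus_pow h n : k h * a x ^+ n = wt h x ^+ n *: (a x ^+ n * k h).
Proof.
elim: n => [|n IH]; first by rewrite !expr0 mulr1 mul1r scale1r.
rewrite !exprS mulrA ka -scalerAl -[a x * k h * _]mulrA IH -scalerAr scalerA.
by rewrite mulrA.
Qed.

Lemma pow_commute n z : x != z -> a x ^+ n * b z = s x z ^+ n *: (b z * a x ^+ n).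
Proof.
move=> /negPf xz; elim: n => [|n IH]; first by rewrite !expr0 mulr1 mul1r scale1r.
rewrite !exprS -[a x * _ * _]mulrA IH -scalerAr (mulrA (a x) (b z)) ab xz mul0r.
rewrite scale0r addr0.
by rewrite -scalerAl scalerA mulrA [s x z * _]mulrC.
Qed.

(** What remains when [b x] is pulled through [a x ^+ n].  At [n = 0] both
    geometric sums are zero, so the truncated exponent [n.-1] does no harm. *)
Definition pow_defect n : A := c x *: (a x ^+ n.-1 *
  (geom_sum (p * Q) n *: k (kk x) - geom_sum (p / Q) n *: k (- kk x))).

Lemma pow_defect0 : pow_defect 0 = 0.
Proof. by rewrite /pow_defect !geom_sum0 !scale0r subrr mulr0 scaler0. Qed.

Lemma pow_cross n : a x ^+ n * b x = p ^+ n *: (b x * a x ^+ n) + pow_defect n.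
Proof.
elim: n => [|n IH].
  by rewrite !expr0 mulr1 mul1r scale1r pow_defect0 addr0.
rewrite [in LHS]exprSr -[a x ^+ n * a x * b x]mulrA ab eqxx mul1r mulrDr -scalerAr.
rewrite mulrA IH mulrDl -scalerAl scalerDr scalerA -exprS -[_ * _ * a x]mulrA.
rewrite -exprSr -addrA; congr (_ + _).
rewrite -scalerAr /pow_defect /= !geom_sumS !scalerDl !scale1r.
have -> : c x *: (a x ^+ n.-1 * (geom_sum (p * Q) n *: k (kk x)
    - geom_sum (p / Q) n *: k (- kk x))) * a x
  = c x *: (a x ^+ n * ((Q * geom_sum (p * Q) n) *: k (kk x)
    - (geom_sum (p / Q) n / Q) *: k (- kk x))).
  case: n {IH} => [|n] /=.
    by rewrite !geom_sum0 mulr0 mul0r !scale0r subrr !mulr0 !scaler0 mul0r.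
  rewrite -scalerAl -mulrA mulrBl -!scalerAl !ka !scalerA weightN exprSr -mulrA.
  by rewrite (mulrBr (a x)) -!scalerAr [Q * _]mulrC.
rewrite scalerA [p * c x]mulrC -[(c x * p) *: _]scalerA -scalerDr; congr (_ *: _).
rewrite scalerAr -mulrDr; congr (_ * _).
rewrite scalerBr !scalerA addrACA -opprD mulrA.
by rewrite [p * (_ / Q)]mulrA [p / Q * _]mulrAC.
Qed.

Hypothesis xy : x != y.
(** The first two conditions are the vanishing of the coefficients of
    [k (kk x)] and [k (- kk x)] when [b x] is pulled through the Serre element,
    the last two that of [k (kk y)] and [k (- kk y)] for [b y]. *)
Hypothesis cf_plus : forall t, (t < N)%N ->
  cf t.+1 * geom_sum (p * Q) t.+1
    + cf t * p ^+ t * s x y * Y * Q ^+ t * geom_sum (p * Q) (N - t) = 0.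
Hypothesis cf_minus : forall t, (t < N)%N ->
  cf t.+1 * geom_sum (p / Q) t.+1
    + cf t * p ^+ t * s x y / Y / Q ^+ t * geom_sum (p / Q) (N - t) = 0.
Hypothesis sum_plus : \sum_(t < N.+1) cf t * s x y ^+ t * Z ^+ t = 0.
Hypothesis sum_minus : \sum_(t < N.+1) cf t * s x y ^+ t / Z ^+ t = 0.

Let expr_split (R : nzRingType) (r : R) (t : 'I_N.+1) :
  r ^+ N = r ^+ (N - t) * r ^+ t.
Proof. by rewrite -exprD subnK ?leq_ord. Qed.

Lemma serre_torus h : qcomm serre_sum (k h).
Proof.
apply/qcomm_sym; exists (wt h x ^+ N * wt h y).
  by rewrite mulf_neq0 ?expf_neq0 ?weight_neq0.
rewrite mulr_sumr mulr_suml scaler_sumr; apply: eq_bigr => t _.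
rewrite -scalerAr !mulrA torus_pow -!scalerAl -!mulrA (mulrA (k h)) ka -!scalerAl.
rewrite -!scalerAr -mulrA torus_pow -!scalerAr !scalerA; congr (_ *: _).
by rewrite (expr_split _ t); ring.
Qed.

Lemma serre_b_other z : x != z -> y != z -> qcomm serre_sum (b z).
Proof.
move=> xz yz; exists (s x z ^+ N * s y z).
  by rewrite mulf_neq0 ?expf_neq0 ?sign_neq0.
have ayz : a y * b z = s y z *: (b z * a y).
  by rewrite ab (negPf yz) mul0r scale0r addr0.
rewrite mulr_sumr mulr_suml scaler_sumr; apply: eq_bigr => t _.
rewrite -scalerAl -[_ * b z]mulrA pow_commute // -scalerAr.
rewrite !mulrA -(mulrA _ (a y) (b z)) ayz.
rewrite -!scalerAr -!scalerAl !mulrA pow_commute // -!scalerAl !scalerA.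
congr (_ *: _).
by rewrite (expr_split _ t); ring.
Qed.

(** The summand of index [t] leaves a torus term in front of [a x ^+ t].
    Moving it to the right end costs [Z ^+ t] or [Z ^- t]; all summands then
    carry the same word [a x ^+ N], so only a scalar sum has to vanish. *)
Lemma serre_b_y : qcomm serre_sum (b y).
Proof.
exists (s x y ^+ N * s y y).
  by rewrite mulf_neq0 ?expf_neq0 ?sign_neq0.
pose d := c y.
have term (t : 'I_N.+1) : a x ^+ (N - t) * a y * a x ^+ t * b y =
    (s x y ^+ N * s y y) *: (b y * (a x ^+ (N - t) * a y * a x ^+ t))
    + s x y ^+ t *: (d *: (a x ^+ N * (Z ^+ t *: k (kk y) - Z ^- t *: k (- kk y)))).
  rewrite -[_ * b y]mulrA pow_commute // -scalerAr.
  rewrite !mulrA -(mulrA _ (a y) (b y)) ab eqxx mul1r (mulrDr (a x ^+ _)) mulrDl.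
  rewrite -!scalerAr -!scalerAl scalerDr; congr (_ + _).
    rewrite !mulrA pow_commute // -!scalerAl !scalerA; congr (_ *: _).
    by rewrite (expr_split _ t); ring.
  congr (_ *: (_ *: _)); rewrite -[LHS]mulrA mulrBl !torus_pow weightN exprVn.
  by rewrite (expr_split _ t) -mulrA (mulrBr (a x ^+ t)) -!scalerAr.
rewrite mulr_sumr mulr_suml scaler_sumr.
under eq_bigr => t _ do rewrite -scalerAl term scalerDr.
rewrite big_split /= -[RHS]addr0; congr (_ + _).
  by apply: eq_bigr => t _; rewrite -scalerAr !scalerA mulrC.
transitivity (d *: (a x ^+ N *
   ((\sum_(t < N.+1) cf t * s x y ^+ t * Z ^+ t) *: k (kk y)
   - (\sum_(t < N.+1) cf t * s x y ^+ t / Z ^+ t) *: k (- kk y)))).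
  rewrite !scaler_suml -sumrB mulr_sumr scaler_sumr; apply: eq_bigr => t _.
  have -> : (cf t * s x y ^+ t * Z ^+ t) *: k (kk y)
      - (cf t * s x y ^+ t / Z ^+ t) *: k (- kk y)
    = (cf t * s x y ^+ t) *: (Z ^+ t *: k (kk y) - Z ^- t *: k (- kk y)).
    by rewrite scalerBr !scalerA.
  by rewrite -scalerAr !scalerA [d * _]mulrC mulrA.
by rewrite sum_plus sum_minus !scale0r subrr mulr0 scaler0.
Qed.

(** The word [a x ^+ (N - t.+1) * a y * a x ^+ t] arises twice: from the
    summand [t.+1], by losing a letter to the right of [a y], and from the
    summand [t], by losing one to its left.  This is how consecutive
    coefficients get related. *)
Lemma serre_b_x : qcomm serre_sum (b x).
Proof.
exists (p ^+ N * s y x).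
  by rewrite mulf_neq0 ?expf_neq0 ?sign_neq0.
have yx : y != x by rewrite eq_sym.
have ayx : a y * b x = s y x *: (b x * a y).
  by rewrite ab (negPf yx) mul0r scale0r addr0.
have term (t : 'I_N.+1) : a x ^+ (N - t) * a y * a x ^+ t * b x =
    (p ^+ N * s y x) *: (b x * (a x ^+ (N - t) * a y * a x ^+ t))
    + (a x ^+ (N - t) * a y * pow_defect t
       + (p ^+ t * s y x) *: (pow_defect (N - t) * a y * a x ^+ t)).
  rewrite -[_ * b x]mulrA pow_cross mulrDr [RHS]addrCA [RHS]addrC; congr (_ + _).
  rewrite -scalerAr !mulrA -(mulrA _ (a y) (b x)) ayx -scalerAr -!scalerAl mulrA.
  rewrite pow_cross !mulrDl -!scalerAl scalerA scalerDr scalerA; congr (_ *: _ + _).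
    by rewrite (expr_split _ t); ring.
have low_a (t : nat) : a x ^+ (N - t.+1) * a y * pow_defect t.+1 =
    c x *: (a x ^+ (N - t.+1) * a y * a x ^+ t *
      (geom_sum (p * Q) t.+1 *: k (kk x) - geom_sum (p / Q) t.+1 *: k (- kk x))).
  by rewrite -scalerAr !mulrA.
have low_b (t : nat) : (t < N)%N -> pow_defect (N - t) * a y * a x ^+ t =
    c x *: (a x ^+ (N - t.+1) * a y * a x ^+ t *
      ((Y * Q ^+ t * geom_sum (p * Q) (N - t)) *: k (kk x)
       - (Y^-1 / Q ^+ t * geom_sum (p / Q) (N - t)) *: k (- kk x))).
  move=> tN; rewrite /pow_defect -!scalerAl -!mulrA subnS; congr (_ *: (_ * _)).
  rewrite mulrBl -!scalerAl !(mulrA (k _)) !ka -!scalerAl -!mulrA !torus_pow.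
  rewrite !weightN exprVn -!scalerAr !scalerA !mulrBr -!scalerAr.
  by congr (_ *: _ - _ *: _); ring.
rewrite mulr_sumr mulr_suml scaler_sumr.
under eq_bigr => t _ do rewrite -scalerAl term scalerDr.
rewrite big_split /= -[RHS]addr0; congr (_ + _).
  by apply: eq_bigr => t _; rewrite -scalerAr !scalerA mulrC.
under eq_bigr => t _ do rewrite scalerDr.
rewrite big_split /= big_ord_recl big_ord_recr /=.
rewrite pow_defect0 mulr0 scaler0 add0r subnn pow_defect0 !mul0r !scaler0 addr0.
rewrite -big_split big1 // => t _ /=.
(* Both contributions to the word with [t] letters on the right are now
   collected, and the torus elements are compared coefficientwise. *)
have swap (d e : K) (u : A) : d *: (e *: u) = e *: (d *: u).
  by rewrite !scalerA mulrC.
rewrite /bump /= add1n low_a low_b // !(swap _ (c x)) -scalerDr !scalerAr -mulrDr.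
rewrite !scalerBr !scalerA addrACA -opprD -!scalerDl.
rewrite [X in X *: k (kk x)](_ : _ = 0); last first.
  by rewrite -(cf_plus (ltn_ord t)) [s y x]sign_sym; ring.
rewrite [X in X *: k (- kk x)](_ : _ = 0); last first.
  by rewrite -(cf_minus (ltn_ord t)) [s y x]sign_sym; ring.
by rewrite !scale0r subrr mulr0 scaler0.
Qed.

Lemma serre_b z : qcomm serre_sum (b z).
Proof.
have [<-|xz] := eqVneq x z; first exact: serre_b_x.
have [<-|yz] := eqVneq y z; first exact: serre_b_y.
exact: serre_b_other.
Qed.

End Serre.

End Algebra.
End Crossing.

(** * A module with basis the sorted words *)
Lemma malg_eq (K : nzRingType) (I : choiceType) (V : lmodType K)
    (f g : {linear {malg K[I]} -> V}) : (forall i, f << i >> = g << i >>) -> f =1 g.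
Proof. by move=> fg u; apply: lspan_eq (malg_span u) => _ [i ->]. Qed.

(** Stated for abstract modules so that the terms of the cross relation are
    split without unfolding the modules in which they live. *)
Lemma linear_comb (K : nzRingType) (V W : lmodType K) (f : {linear V -> W})
    c d x y z :
  f (c *: x + d *: (y - z)) = c *: f x + d *: (f y - f z).
Proof. by rewrite linearD !linearZ linearB. Qed.

Section Action.
Variables (K : comNzRingType) (G : choiceType) (W : lmodType K).
Variable op : G -> {linear W -> W}.
Local Notation F := (free_alg K G).

Fixpoint word_op (m : seq G) : {linear W -> W} :=
  if m is g :: m' then (op g \o word_op m')%FUN else idfun.

Lemma word_op_cat m n u : word_op (m ++ n) u = word_op m (word_op n u).
Proof. by elim: m => //= g m ->. Qed.

(** The vector precedes the algebra element because linearity in the latter is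
    what the later proofs use. *)
Definition free_act (u : W) : {linear F -> W} :=
  malg_ext (fun m : {fmonom G} => word_op m u).

Lemma free_act_word u (m : {fmonom G}) : free_act u << m >> = word_op m u.
Proof. exact: malg_extU. Qed.

Lemma free_act_gen u g : free_act u (free_gen K g) = op g u.
Proof. by rewrite free_act_word fmU. Qed.

Lemma free_act1 u : free_act u 1 = u.
Proof. by rewrite free_act_word fm1. Qed.

Lemma free_actM u x y : free_act u (x * y) = free_act (free_act u y) x.
Proof.
have: lspan (fun x => exists i, x = << i >>) x by apply: malg_span.
elim=> {x} [|_ [m ->]|x x' _ IH _ IH'|c x _ IH].
- by rewrite mul0r !linear0.
- rewrite free_act_word.
  have E := @malg_eq _ _ _ (free_act u \o (<< m >> \*o idfun))%FUN
              (word_op m \o free_act u)%FUN.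
  apply: E => n /=; rewrite free_act_word.
  have -> : << m >> * << n >> = << mmul m n >> :> F by rewrite [LHS]fgmulUU mul1r.
  by rewrite free_act_word fmM word_op_cat.
- rewrite mulrDl (linearD (free_act u)) (linearD (free_act (free_act u y))).
  by congr (_ + _).
- rewrite -scalerAl (linearZ_LR (free_act u)).
  by rewrite (linearZ_LR (free_act (free_act u y))); congr (_ *: _).
Qed.

Lemma free_act0 x : free_act 0 x = 0.
Proof.
apply: (@lspan_ker _ _ _ (free_act 0)) (malg_span x) => _ [m ->].
by rewrite free_act_word linear0.
Qed.

End Action.

(** The analogue of a universal Verma module, with the words q^h a..a in place
    of a highest weight vector.  The module is an abstract [W] with a family
    [e] on which endomorphisms can be prescribed freely, so that no computation
    unfolds a concrete free module. *)
Section Verma.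
Variables (K : fieldType) (D : crossing_datum K).
Local Notation X := (letter D).
Local Notation H := (torus D).
Local Notation wt := (@weight K D).
Local Notation s := (@sign K D).
Local Notation kk := (@kappa K D).
Variable c : X -> K.

Local Notation pbw := (seq X * H * seq X)%type.
Variables (W : lmodType K) (e : seq X -> H -> seq X -> W).
Variable ext : (pbw -> W) -> {linear W -> W}.
Hypothesis extE : forall f v h w, ext f (e v h w) = f (v, h, w).
Hypothesis ext_eq : forall f g : {linear W -> W},
  (forall v h w, f (e v h w) = g (e v h w)) -> f =1 g.

Definition op_b (x : X) : {linear W -> W} :=
  ext (fun m : pbw => e (x :: m.1.1) m.1.2 m.2).
Definition op_k (g : H) : {linear W -> W} :=
  ext (fun m : pbw => (\prod_(y <- m.1.1) wt (- g) y) *: e m.1.1 (g + m.1.2) m.2).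
Definition cross_const (x y : X) : K := (x == y)%:R * c x.
(** The cross relation turned into a recursive definition: it computes where
    [a x] ends up when it is sorted into the word. *)
Fixpoint op_a_word (x : X) (v : seq X) (h : H) (w : seq X) : W :=
  if v is y :: v' then
    s x y *: op_b y (op_a_word x v' h w)
    + cross_const x y *: (op_k (kk x) (e v' h w) - op_k (- kk x) (e v' h w))
  else wt (- h) x *: e [::] h (x :: w).
Definition op_a (x : X) : {linear W -> W} :=
  ext (fun m : pbw => op_a_word x m.1.1 m.1.2 m.2).

Lemma op_bE x v h w : op_b x (e v h w) = e (x :: v) h w.
Proof. exact: extE. Qed.
Lemma op_kE g v h w :
  op_k g (e v h w) = (\prod_(y <- v) wt (- g) y) *: e v (g + h) w.
Proof. exact: extE. Qed.
Lemma op_aE x v h w : op_a x (e v h w) = op_a_word x v h w.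
Proof. exact: extE. Qed.

#[local] Opaque op_b op_k op_a.

Lemma op_k0 u : op_k 0 u = u.
Proof.
apply: (@ext_eq (op_k 0) idfun) => v h w.
by rewrite op_kE big1 ?scale1r ?add0r // => y _; rewrite oppr0 weight0.
Qed.

Lemma op_kD g h u : op_k (g + h) u = op_k g (op_k h u).
Proof.
apply: (@ext_eq (op_k (g + h)) (op_k g \o op_k h)%FUN) => v h' w /=.
rewrite !op_kE (linearZ_LR (op_k g)) op_kE scalerA -big_split addrA; congr (_ *: _).
by apply: eq_bigr => y _ /=; rewrite opprD weightD mulrC.
Qed.

Lemma op_kb g x u : op_k g (op_b x u) = wt (- g) x *: op_b x (op_k g u).
Proof.
apply: (@ext_eq (op_k g \o op_b x)%FUN (wt (- g) x \*: op_b x \o op_k g)%FUN).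
move=> v h w /=.
by rewrite op_bE !op_kE (linearZ_LR (op_b x)) op_bE scalerA big_cons.
Qed.

Lemma op_ab x y u : op_a x (op_b y u) = s x y *: op_b y (op_a x u)
  + cross_const x y *: (op_k (kk x) u - op_k (- kk x) u).
Proof.
move: u; apply: (@ext_eq (op_a x \o op_b y)%FUN
  ((s x y \*: (op_b y \o op_a x))
    \+ (cross_const x y \*: (op_k (kk x) \- op_k (- kk x))))%FUN).
by move=> v h w /=; rewrite op_bE !op_aE.
Qed.

(** Not visible from the recursion, hence proved along it.  A torus term occurs
    only for [x = y], where the weights of [a x] and [b y] cancel each other. *)
Lemma op_ka g x u : op_k g (op_a x u) = wt g x *: op_a x (op_k g u).
Proof.
apply: (@ext_eq (op_k g \o op_a x)%FUN (wt g x \*: (op_a x \o op_k g))%FUN).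
move=> v h w /=.
elim: v h w => [|y v IH] h w.
  rewrite op_aE op_kE /= (linearZ_LR (op_k g)) (linearZ_LR (op_a x)) op_kE op_aE /=.
  rewrite !big_nil !scale1r scalerA.
  by rewrite -weightD opprD addrA subrr add0r.
rewrite -op_bE op_ab op_kb (linearD (op_k g)) !(linearZ_LR (op_k g)).
rewrite (linearZ_LR (op_a x)).
rewrite op_kb IH.
rewrite op_ab (linearB (op_k g)) -!op_kD ![_ + g]addrC.
rewrite (linearZ_LR (op_b y)) !scalerA (scalerDr (wt g x * _)) !scalerA.
congr (_ *: _ + _ *: _); first by ring.
rewrite /cross_const; have [->|] := eqVneq x y; last by rewrite !mul0r mulr0.
by rewrite -weightD subrr weight0 mul1r.
Qed.

Local Notation G := (X + X + H)%type.
Local Notation F := (free_alg K G).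

Definition free_a (x : X) : F := free_gen K (inl (inl x) : G).
Definition free_b (x : X) : F := free_gen K (inl (inr x) : G).
Definition free_k (h : H) : F := free_gen K (inr h : G).

Inductive cross_relator : F -> Prop :=
| cross_k0 : cross_relator (free_k 0 - 1)
| cross_kD g h : cross_relator (free_k (g + h) - free_k g * free_k h)
| cross_ka h x :
    cross_relator (free_k h * free_a x - wt h x *: (free_a x * free_k h))
| cross_kb h x :
    cross_relator (free_k h * free_b x - wt (- h) x *: (free_b x * free_k h))
| cross_a_b x y :
    cross_relator (free_a x * free_b y - (s x y *: (free_b y * free_a x)
      + cross_const x y *: (free_k (kk x) - free_k (- kk x)))).

Definition pbw_op (g : G) : {linear W -> W} :=
  match g with inl (inl x) => op_a x | inl (inr x) => op_b x | inr h => op_k h end.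

Definition vacuum : W := e [::] 0 [::].

Lemma cross_relator0 r u : cross_relator r -> free_act pbw_op u r = 0.
Proof.
have genE g v : free_act pbw_op v (free_gen K g) = pbw_op g v.
  exact: free_act_gen.
have mulE g h v :
    free_act pbw_op v (free_gen K g * free_gen K h) = pbw_op g (pbw_op h v).
  by rewrite free_actM (genE h) (genE g).
pose a x : G := inl (inl x); pose b x : G := inl (inr x); pose k h : G := inr h.
case=> [|g h|h x|h x|x y]; rewrite (linearB (free_act pbw_op u)); apply/eqP;
  rewrite subr_eq0; apply/eqP.
- by rewrite (genE (k 0)) free_act1 op_k0.
- by rewrite (genE (k (g + h))) (mulE (k g) (k h)) op_kD.
- rewrite (mulE (k h) (a x)) (linearZ_LR (free_act pbw_op u)) (mulE (a x) (k h)).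
  exact: op_ka.
- rewrite (mulE (k h) (b x)) (linearZ_LR (free_act pbw_op u)) (mulE (b x) (k h)).
  exact: op_kb.
- rewrite (mulE (a x) (b y)) (linear_comb (free_act pbw_op u)).
  by rewrite (mulE (b y) (a x)) (genE (k (kk x))) (genE (k (- kk x))) -op_ab.
Qed.

Lemma two_sided_cross0 u x :
  lspan (two_sided cross_relator) x -> free_act pbw_op u x = 0.
Proof.
apply: lspan_ker => _ [l [r [l' [Rr ->]]]].
by rewrite !free_actM (cross_relator0 _ Rr) free_act0.
Qed.

Lemma pbw_coordinates : exists f : {linear F -> W},
  (forall x, lspan (two_sided cross_relator) x -> f x = 0) /\
  forall v h w,
    f (\prod_(x <- v) free_b x * free_k h * \prod_(x <- w) free_a x) = e v h w.
Proof.
exists (free_act pbw_op vacuum); split=> [x|v h w]; first exact: two_sided_cross0.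
rewrite !free_actM.
have -> : free_act pbw_op vacuum (\prod_(x <- w) free_a x) = e [::] 0 w.
  elim: w => [|x w IH]; first by rewrite big_nil free_act1.
  by rewrite big_cons free_actM IH free_act_gen op_aE /= oppr0 weight0 scale1r.
rewrite free_act_gen op_kE big_nil scale1r addr0.
elim: v => [|x v IH]; first by rewrite big_nil free_act1.
by rewrite big_cons free_actM IH free_act_gen op_bE.
Qed.

End Verma.

Section CrossAlgebra.
Variables (K : fieldType) (D : crossing_datum K) (c : letter D -> K).
Local Notation X := (letter D).
Local Notation H := (torus D).
Local Notation G := (X + X + H)%type.
Local Notation F := (free_alg K G).
Local Notation pbw := (seq X * H * seq X)%type.

Lemma cross_coordinates : exists f : {linear F -> {malg K[pbw]}},
  (forall x, lspan (two_sided (cross_relator c)) x -> f x = 0) /\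
  forall v h w,
    f (\prod_(x <- v) free_b x * free_k h * \prod_(x <- w) free_a x) = << (v, h, w) >>.
Proof.
pose e v h w : {malg K[pbw]} := << (v, h, w) >>.
pose ext (f : pbw -> {malg K[pbw]}) : {linear {malg K[pbw]} -> {malg K[pbw]}} :=
  malg_ext f.
apply: (@pbw_coordinates K D c {malg K[pbw]} e ext) => [f v h w|f g fg].
  exact: malg_extU.
by apply: malg_eq => -[[v h] w]; apply: fg.
Qed.

(** Otherwise 1 would act as zero on a nonzero module. *)
Fact cross_relator_proper : 1 \notin lspanb (two_sided (cross_relator c)).
Proof.
have [f [f0 fE]] := cross_coordinates; apply/negP => /lspanP /f0 f1.
have := fE [::] 0 [::]; rewrite !big_nil mul1r mulr1.
rewrite (_ : free_k 0 = 1 + (free_k 0 - 1)); last by rewrite addrC subrK.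
rewrite linearD f1 f0; last first.
  apply: lspan_mem; exists 1, (free_k 0 - 1), 1.
  by rewrite mul1r mulr1; split=> //; constructor.
by rewrite addr0 => /esym/eqP; rewrite monalgU_eq0 oner_eq0.
Qed.

Definition cross_alg : algType K := quot_alg (Relations cross_relator_proper).
Local Notation pi := (quot_alg_pi (Relations cross_relator_proper)).
Definition cross_a x : cross_alg := pi (free_a x).
Definition cross_b x : cross_alg := pi (free_b x).
Definition cross_k h : cross_alg := pi (free_k h).

Lemma quot_alg_pi0 (A : algType K) (R : relations A) r :
  R r -> quot_alg_pi R r = 0.
Proof.
move=> Rr; rewrite -(raddf0 (quot_alg_pi R)); apply/quot_piE/lspanP/lspan_mem.
by exists 1, r, 1; rewrite mulr1 mul1r subr0.
Qed.

Lemma quot_alg_crossing (R : relations F) :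
    (forall r, cross_relator c r -> quot_alg_pi R r = 0) ->
  crossing c (fun x => quot_alg_pi R (free_a x)) (fun x => quot_alg_pi R (free_b x))
    (fun h => quot_alg_pi R (free_k h)).
Proof.
move=> R0; have piE x y : cross_relator c (x - y) -> quot_alg_pi R x = quot_alg_pi R y.
  by move=> /R0; rewrite (rmorphB (quot_alg_pi R)) => /eqP; rewrite subr_eq0 => /eqP.
split.
- by rewrite [LHS](piE _ _ (@cross_k0 K D c)) (rmorph1 (quot_alg_pi R)).
- by move=> g h; rewrite [LHS](piE _ _ (@cross_kD K D c g h)) (rmorphM (quot_alg_pi R)).
- move=> h x; have := piE _ _ (@cross_ka K D c h x).
  by rewrite (linearZ_LR (quot_alg_pi R)) !(rmorphM (quot_alg_pi R)).
- move=> h x; have := piE _ _ (@cross_kb K D c h x).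
  by rewrite (linearZ_LR (quot_alg_pi R)) !(rmorphM (quot_alg_pi R)).
- move=> x y; have := piE _ _ (@cross_a_b K D c x y).
  by rewrite (linear_comb (quot_alg_pi R)) !(rmorphM (quot_alg_pi R)).
Qed.

Lemma cross_alg_crossing : crossing c cross_a cross_b cross_k.
Proof. by apply: quot_alg_crossing => r Rr; apply: quot_alg_pi0. Qed.

(** Linear independence of the sorted words: the coordinates of an element are
    those of its action on the empty word. *)
Lemma cross_normal_form : exists phi : {linear cross_alg -> {malg K[pbw]}},
  forall v h w, phi (\prod_(x <- v) cross_b x * cross_k h * \prod_(x <- w) cross_a x)
    = << (v, h, w) >>.
Proof.
have [f [f0 fE]] := cross_coordinates.
have [|phi phiE] := @quot_lift _ _ _ (two_sided (cross_relator c)) f.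
  by move=> x Ix; apply: f0; apply: lspan_mem.
by exists phi => v h w; rewrite -!rmorph_prod -!rmorphM [LHS]phiE fE.
Qed.

Lemma free_quot_span (R : relations F) (u : quot_alg R) :
    (forall r, cross_relator c r -> quot_alg_pi R r = 0) ->
  lspan (words (fun x => quot_alg_pi R (free_b x)) (fun x => quot_alg_pi R (free_a x))
           (fun h => quot_alg_pi R (free_k h))) u.
Proof.
move=> /quot_alg_crossing rels.
rewrite -[u]quot_reprK; apply: (@lspan_map _ _ _ (quot_alg_pi R)) (malg_span _).
move=> _ [[m] ->]; elim: m => [|g m IH].
  refine (eq_ind 1 (lspan _) (span_1 rels) _ _).
  rewrite -(rmorph1 (quot_alg_pi R)); congr (quot_alg_pi R << _ >>).
  by apply: val_inj; rewrite /= fm1.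
have -> : << FMonom (g :: m) >> = free_gen K g * << FMonom m >> :> F.
  rewrite [RHS]fgmulUU mul1r; congr << _ >>.
  by apply: val_inj; rewrite /= fmM fmU.
rewrite (rmorphM (quot_alg_pi R)).
case: g => [[x|x]|h]; [exact: (span_a rels) | exact: span_b | exact: (span_k rels)].
Qed.

End CrossAlgebra.

(** * Spans of words in subalgebras and tensor products *)
Lemma lspan_mul (K : nzRingType) (A : algType K) (M : A -> Prop) x y :
    (forall x y, M x -> M y -> M (x * y)) ->
  lspan M x -> lspan M y -> lspan M (x * y).
Proof.
move=> MM Mx; elim: Mx y => {x} [|x Mx|x x' _ IH _ IH'|c x _ IH] y My.
- by rewrite mul0r; apply: lspan_zero.
- apply: (@lspan_map _ _ _ (x \*o idfun)) My => y' My'.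
  by apply: lspan_mem; apply: MM.
- by rewrite mulrDl; apply: lspan_add; [apply: IH | apply: IH'].
- by rewrite -scalerAl; apply/lspan_scale/IH.
Qed.

Lemma gen_subalg_span (K : nzRingType) (A : algType K) (S M : A -> Prop) x :
    M 1 -> (forall x y, M x -> M y -> M (x * y)) -> (forall x, S x -> M x) ->
  gen_subalg S x -> lspan M x.
Proof.
move=> M1 MM SM; elim=> {x} [x Sx||x y _ Mx _ My|c x _ Mx|x y _ Mx _ My].
- by apply: lspan_mem; apply: SM.
- exact: lspan_mem.
- exact: lspan_add.
- exact: lspan_scale.
- exact: lspan_mul.
Qed.

Lemma subalgebra_span (K : nzRingType) (A : algType K) (S : A -> Prop)
    (M : subalgebra S -> Prop) (x : subalgebra S) :
    M 1 -> (forall x y, M x -> M y -> M (x * y)) -> (forall x, S (val x) -> M x) ->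
  lspan M x.
Proof.
move=> M1 MM SM; pose sub u (p : u \in gen_subalgb S) : subalgebra S := exist _ u p.
suff subM u (p : u \in gen_subalgb S) : lspan M (sub u p).
  by case: x => u; apply: subM.
have /gen_subalgP gu := p; elim: gu p => {u} [u Su|
  |u v /gen_subalgP gu IHu /gen_subalgP gv IHv|d u /gen_subalgP gu IHu
  |u v /gen_subalgP gu IHu /gen_subalgP gv IHv] p.
- exact/lspan_mem/SM.
- by apply: lspan_mem; rewrite (_ : sub _ p = 1) //; apply: val_inj.
- rewrite (_ : sub _ p = sub _ gu + sub _ gv); last exact: val_inj.
  exact: lspan_add.
- rewrite (_ : sub _ p = d *: sub _ gu); last exact: val_inj.
  exact: lspan_scale.
- rewrite (_ : sub _ p = sub _ gu * sub _ gv); last exact: val_inj.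
  exact: lspan_mul.
Qed.

Definition monomial (A : pzRingType) (I : Type) (g : I -> A) (u : A) : Prop :=
  exists w, u = \prod_(x <- w) g x.

Lemma monomial1 (A : pzRingType) (I : Type) (g : I -> A) : monomial g 1.
Proof. by exists [::]; rewrite big_nil. Qed.

Lemma monomialM (A : pzRingType) (I : Type) (g : I -> A) u v :
  monomial g u -> monomial g v -> monomial g (u * v).
Proof. by move=> [w ->] [w' ->]; exists (w ++ w'); rewrite big_cat. Qed.

Lemma monomial_gen (A : pzRingType) (I : Type) (g : I -> A) x : monomial g (g x).
Proof. by exists [:: x]; rewrite big_seq1. Qed.

Lemma tens_span_span (K : comNzRingType) (V W : lmodType K) (SV : V -> Prop)
    (SW : W -> Prop) (t : (V ⊗ W)%type) :
    (forall v, lspan SV v) -> (forall w, lspan SW w) ->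
  lspan (fun t => exists v w, [/\ SV v, SW w & t = (v ⊗ w)%tensor]) t.
Proof.
move=> Vspan Wspan; apply: lspan_sub (tens_span t) => _ [v [w ->]].
elim: (Vspan v) w => {v} [|v Sv|v v' _ IH _ IH'|c v _ IH] w.
- by rewrite tens0l; apply: lspan_zero.
- elim: (Wspan w) => {w} [|w Sw|w w' _ IH _ IH'|c w _ IH].
  + by rewrite tens0r; apply: lspan_zero.
  + by apply: lspan_mem; exists v, w.
  + by rewrite tensDr; apply: lspan_add.
  + by rewrite tensZr; apply: lspan_scale.
- by rewrite tensDl; apply: lspan_add.
- by rewrite tensZl; apply: lspan_scale.
Qed.

(** * Triangular decomposition for relations that commute past the other half *)

(** [Ut] has the sorted words as a basis ([Ut_span], [Ut_free]), and [psi]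
    presents [A] as the quotient of [Ut] by the two-sided ideal generated by
    [Rt]; the last condition on [psi] is the universal property of that
    quotient. *)
Section Decomposition.
Variables (K : fieldType) (D : crossing_datum K) (c : letter D -> K).
Local Notation X := (letter D).
Local Notation H := (torus D).

Variables (Ut : algType K) (ta tb : X -> Ut) (tk : H -> Ut).
Hypothesis Ut_span : forall u, lspan (words tb ta tk) u.
Hypothesis Ut_free : forall (V : lmodType K) (f : seq X -> H -> seq X -> V),
  exists Phi : {linear Ut -> V}, forall v h w,
    Phi (\prod_(x <- v) tb x * tk h * \prod_(x <- w) ta x) = f v h w.

Variable (Rt : Ut -> Prop).
Hypothesis Rt_cases : forall S, Rt S ->
  [\/ S = 0,
      [/\ gen_subalg (fun u => exists x, u = ta x) S,
          forall z, qcomm S (tb z) & forall h, qcomm S (tk h)]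
    | [/\ gen_subalg (fun u => exists x, u = tb x) S,
          forall z, qcomm S (ta z) & forall h, qcomm S (tk h)]].

Variables (A : algType K) (aa ab : X -> A) (ak : H -> A).
Hypothesis A_cross : crossing c aa ab ak.
Variable psi : {linear Ut -> A}.
Hypothesis psi1 : psi 1 = 1.
Hypothesis psiM : forall u v, psi (u * v) = psi u * psi v.
Hypothesis psi_a : forall x, psi (ta x) = aa x.
Hypothesis psi_b : forall x, psi (tb x) = ab x.
Hypothesis psi_k : forall h, psi (tk h) = ak h.
Hypothesis psi_onto : forall u, exists t, u = psi t.
Hypothesis psi_Rt : forall S, Rt S -> psi S = 0.
Hypothesis psi_lift : forall (V : lmodType K) (f : {linear Ut -> V}),
  (forall u S v, Rt S -> f (u * S * v) = 0) ->
  exists g : {linear A -> V}, forall u, g (psi u) = f u.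

Local Notation Ap := (subalgebra (fun u : A => exists x, u = aa x)).
Local Notation Am := (subalgebra (fun u : A => exists x, u = ab x)).
Local Notation A0 := (subalgebra (fun u : A => exists h, u = ak h)).

Let in_gen (I : Type) (g : I -> A) x : g x \in gen_subalgb (fun u => exists x, u = g x).
Proof. by apply/gen_subalgP/gen_subalg_mem; exists x. Qed.
Let ap x : Ap := exist (fun u => u \in gen_subalgb _) _ (in_gen aa x).
Let am x : Am := exist (fun u => u \in gen_subalgb _) _ (in_gen ab x).
Let a0 h : A0 := exist (fun u => u \in gen_subalgb _) _ (in_gen ak h).

Let ap_span (z : Ap) : lspan (monomial ap) z.
Proof.
apply: subalgebra_span; [exact: monomial1 | exact: monomialM | move=> {}z [x zx]].
by rewrite (_ : z = ap x); [exact: monomial_gen | exact: val_inj].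
Qed.

Let am_span (z : Am) : lspan (monomial am) z.
Proof.
apply: subalgebra_span; [exact: monomial1 | exact: monomialM | move=> {}z [x zx]].
by rewrite (_ : z = am x); [exact: monomial_gen | exact: val_inj].
Qed.

Let a0_span (z : A0) : lspan (fun u => exists h, u = a0 h) z.
Proof.
apply: subalgebra_span.
- by exists 0; apply: val_inj; rewrite /= (torus_1 A_cross).
- move=> _ _ [g ->] [h ->]; exists (g + h).
  by apply: val_inj; rewrite /= (torus_D A_cross).
- by move=> {}z [h zh]; exists h; apply: val_inj.
Qed.

Local Open Scope tensor_scope.
Local Notation T := (Am ⊗ A0 ⊗ Ap)%type.

Let psi_ta w : psi (\prod_(x <- w) ta x) = val (\prod_(x <- w) ap x).
Proof.
elim: w => [|x w IH]; first by rewrite !big_nil psi1.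
by rewrite !big_cons psiM IH psi_a.
Qed.

Let psi_tb w : psi (\prod_(x <- w) tb x) = val (\prod_(x <- w) am x).
Proof.
elim: w => [|x w IH]; first by rewrite !big_nil psi1.
by rewrite !big_cons psiM IH psi_b.
Qed.

Let words_psi u : lspan (fun x => exists v h w,
  x = psi (\prod_(x <- v) tb x * tk h * \prod_(x <- w) ta x)) u.
Proof.
have [t ->] := psi_onto u; apply: lspan_map (Ut_span t) => _ [v [h [w ->]]].
by apply: lspan_mem; exists v, h, w.
Qed.

Section Descent.
Variable Phi : {linear Ut -> T}.
Hypothesis PhiE : forall v h w,
  Phi (\prod_(x <- v) tb x * tk h * \prod_(x <- w) ta x)
  = (\prod_(x <- v) am x) ⊗ a0 h ⊗ (\prod_(x <- w) ap x).

(** [Phi] takes values in a tensor product of subalgebras of [A], where a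
    relation holds as soon as it holds in [A]. *)
Let Phi_a S : lspan (monomial ta) S -> psi S = 0 ->
  forall v h, Phi (\prod_(x <- v) tb x * tk h * S) = 0.
Proof.
move=> aS S0.
have [z zS PhiS] : exists2 z : Ap, val z = psi S & forall v h,
    Phi (\prod_(x <- v) tb x * tk h * S) = (\prod_(x <- v) am x) ⊗ a0 h ⊗ z.
  elim: aS {S0} => {S} [|_ [w ->]|S S' _ [z zS IH] _ [z' zS' IH']|d S _ [z zS IH]].
  - exists 0; first by rewrite (linear0 psi).
    by move=> v h; rewrite mulr0 (linear0 Phi) tens0r.
  - by exists (\prod_(x <- w) ap x) => [|v h]; rewrite ?psi_ta ?PhiE.
  - exists (z + z'); first by rewrite (linearD psi) -zS -zS'.
    by move=> v h; rewrite mulrDr (linearD Phi) IH IH' tensDr.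
  - exists (d *: z); first by rewrite (linearZ_LR psi) -zS.
    by move=> v h; rewrite -scalerAr (linearZ_LR Phi) IH tensZr.
move=> v h; rewrite PhiS (_ : z = 0) ?tens0r //.
by apply: val_inj; rewrite zS S0.
Qed.

Let Phi_b S : lspan (monomial tb) S -> psi S = 0 ->
  forall h w, Phi (S * tk h * \prod_(x <- w) ta x) = 0.
Proof.
move=> aS S0.
have [z zS PhiS] : exists2 z : Am, val z = psi S & forall h w,
    Phi (S * tk h * \prod_(x <- w) ta x) = z ⊗ a0 h ⊗ (\prod_(x <- w) ap x).
  elim: aS {S0} => {S} [|_ [w ->]|S S' _ [z zS IH] _ [z' zS' IH']|d S _ [z zS IH]].
  - exists 0; first by rewrite (linear0 psi).
    by move=> h w; rewrite !mul0r (linear0 Phi) !tens0l.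
  - by exists (\prod_(x <- w) am x) => [|v h]; rewrite ?psi_tb ?PhiE.
  - exists (z + z'); first by rewrite (linearD psi) -zS -zS'.
    by move=> v h; rewrite !mulrDl (linearD Phi) IH IH' !tensDl.
  - exists (d *: z); first by rewrite (linearZ_LR psi) -zS.
    by move=> v h; rewrite -!scalerAl (linearZ_LR Phi) IH !tensZl.
move=> v h; rewrite PhiS (_ : z = 0) ?tens0l //.
by apply: val_inj; rewrite zS S0.
Qed.

(** If [S] is a polynomial in the [a]s, the [b]s and the torus part of [v] move
    to the left of [S]; once the left factor is sorted, [S] lies inside the
    [a]-part of sorted words, on which [Phi] vanishes by [Phi_a].  If [S] is a
    polynomial in the [b]s, the [a]s and the torus part of [u] move to the
    right instead. *)
Lemma Phi_ideal u S v : Rt S -> Phi (u * S * v) = 0.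
Proof.
move=> RS; have S0 := psi_Rt RS.
have monoM (g : X -> Ut) x y := @lspan_mul _ _ (monomial g) x y (@monomialM _ _ g).
have mono (g : X -> Ut) w : lspan (monomial g) (\prod_(x <- w) g x).
  by apply: lspan_mem; exists w.
have gen_mono (g : X -> Ut) : gen_subalg (fun u => exists x, u = g x) S ->
    lspan (monomial g) S.
  apply: gen_subalg_span => [|x y|_ [x ->]].
  - exact: monomial1.
  - exact: monomialM.
  - exact: monomial_gen.
case: (Rt_cases RS) => [->|[/gen_mono aS Sb Sk]|[/gen_mono bS Sa Sk]].
- by rewrite mulr0 mul0r linear0.
- apply: (@lspan_ker _ _ _ (Phi \o ((u * S) \*o idfun))%FUN _ _ _ (Ut_span v)).
  move=> _ [v1 [h1 [w1 ->]]] /=.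
  have [d _ Sg] : qcomm S (\prod_(x <- v1) tb x * tk h1).
    by apply: qcommMr => //; apply: qcomm_prod.
  rewrite mulrA -[u * S * _]mulrA Sg -scalerAr -scalerAl linearZ /=.
  rewrite mulrA -[_ * S * _]mulrA.
  set g := u * _; set S' := S * _.
  suff -> : Phi (g * S') = 0 by rewrite scaler0.
  apply: (@lspan_ker _ _ _ (Phi \o (S' \o* idfun))%FUN _ _ _ (Ut_span g)).
  move=> _ [v2 [h2 [w2 ->]]] /=; rewrite -[_ * S']mulrA; apply: Phi_a.
    by apply: (monoM ta) => //; apply: (monoM ta).
  by rewrite !psiM S0 mul0r mulr0.
- rewrite -mulrA.
  apply: (@lspan_ker _ _ _ (Phi \o ((S * v) \o* idfun))%FUN _ _ _ (Ut_span u)).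
  move=> _ [v1 [h1 [w1 ->]]] /=.
  have [d _ Sg] : qcomm (tk h1 * \prod_(x <- w1) ta x) S.
    by apply/qcomm_sym; apply: qcommMr => //; apply: qcomm_prod.
  set B := \prod_(x <- v1) tb x; set C := \prod_(x <- w1) ta x.
  have -> : B * tk h1 * C * (S * v) = d *: (B * S * (tk h1 * C * v)).
    transitivity (B * (tk h1 * C * S) * v); first by rewrite !mulrA.
    by rewrite Sg -scalerAr -scalerAl !mulrA.
  rewrite linearZ /=; set g := tk h1 * C * v; set S' := B * S.
  suff -> : Phi (S' * g) = 0 by rewrite scaler0.
  apply: (@lspan_ker _ _ _ (Phi \o (S' \*o idfun))%FUN _ _ _ (Ut_span g)).
  move=> _ [v2 [h2 [w2 ->]]] /=; rewrite !mulrA; apply: Phi_b.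
    by apply: (monoM tb); [apply: (monoM tb) => //; exact: mono | exact: mono].
  by rewrite !psiM S0 mulr0 mul0r.
Qed.

End Descent.

(** The map induced by [Phi] on [A] inverts multiplication; both composites are
    identities because they are so on sorted words. *)
Lemma triangular_decomposition : exists m : {linear T -> A},
  (forall x y z, m (x ⊗ y ⊗ z) = val x * val y * val z) /\ bijective m.
Proof.
have [m1 m1E] : exists m1 : {linear (Am ⊗ A0)%type -> A},
    forall x y, m1 (x ⊗ y) = val x * val y.
  apply: tens_lift => [y|x] d u v.
  - by rewrite linearP mulrDl -scalerAl.
  - by rewrite linearP mulrDr -scalerAr.
have [m mE] : exists m : {linear T -> A}, forall x z, m (x ⊗ z) = m1 x * val z.
  apply: tens_lift => [y|x] d u v.
  - by rewrite linearP mulrDl -scalerAl.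
  - by rewrite linearP mulrDr -scalerAr.
have {m1 m1E}mE x y z : m (x ⊗ y ⊗ z) = val x * val y * val z by rewrite mE m1E.
have [Phi PhiE] := Ut_free (fun v h w =>
  (\prod_(x <- v) am x) ⊗ a0 h ⊗ (\prod_(x <- w) ap x)).
have [r rE] := psi_lift (Phi_ideal PhiE).
have word v h w : m ((\prod_(x <- v) am x) ⊗ a0 h ⊗ (\prod_(x <- w) ap x))
    = psi (\prod_(x <- v) tb x * tk h * \prod_(x <- w) ta x).
  by rewrite mE !psiM psi_ta psi_tb psi_k.
have mK v h w : r (m ((\prod_(x <- v) am x) ⊗ a0 h ⊗ (\prod_(x <- w) ap x)))
    = (\prod_(x <- v) am x) ⊗ a0 h ⊗ (\prod_(x <- w) ap x).
  by rewrite word rE PhiE.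
exists m; split=> //; exists r => [t|u].
- have T1 := fun t1 => tens_span_span t1 am_span a0_span.
  apply: (lspan_cancel (f := m) (g := r)) (tens_span_span t T1 ap_span).
  by move=> _ [_ [_ [[_ [_ [[v ->] [h ->] ->]]] [w ->] ->]]].
- apply: (lspan_cancel (f := r) (g := m)) (words_psi u) => _ [v [h [w ->]]].
  by rewrite rE PhiE word.
Qed.

End Decomposition.

(** * Super quantum integers and the Serre coefficients *)
Section SuperQuantumIntegers.
Variables (K : fieldType) (p v : K).
Hypothesis p_sq : p * p = 1.
Hypothesis v_neq0 : v != 0.

(** The integer [n]_i for p = (-1)^p(i) and v = q_i. *)
Definition sqint n : K := ((p * v) ^+ n - v ^- n) / (p * v - v^-1).

Hypothesis v_generic : forall n, (0 < n)%N -> v ^+ n != 1.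

Let p_cases : p = 1 \/ p = -1.
Proof.
have /eqP : (p - 1) * (p + 1) = 0 by ring: p_sq.
by rewrite mulf_eq0 subr_eq0 addr_eq0 => /orP[] /eqP; [left | right].
Qed.

Let pow_cases n : p ^+ n = 1 \/ p ^+ n = -1.
Proof.
elim: n => [|n]; first by left.
by rewrite exprS; case: p_cases => -> [] ->; rewrite ?mulNr ?mul1r ?opprK; auto.
Qed.

Let pv_neq n : (0 < n)%N -> (p * v) ^+ n != v ^- n.
Proof.
move=> n0; apply/eqP => E.
have vn : v ^+ n != 0 by rewrite expf_neq0.
have pv2 : p ^+ n * (v ^+ n * v ^+ n) = 1.
  by rewrite mulrA -exprMn E mulVf.
have n4 : (0 < n * 4)%N by rewrite muln_gt0 n0.
move/eqP: (v_generic n4); apply.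
rewrite exprM (_ : v ^+ n ^+ 4 = (p ^+ n * (v ^+ n * v ^+ n)) ^+ 2).
  by rewrite pv2 expr1n.
by case: (pow_cases n) => ->; ring.
Qed.

Let den_neq0 : p * v - v^-1 != 0.
Proof. by rewrite subr_eq0; have := @pv_neq 1%N isT; rewrite !expr1. Qed.

Lemma sqint_neq0 n : (0 < n)%N -> sqint n != 0.
Proof. by move=> n0; rewrite mulf_neq0 ?invr_eq0 // subr_eq0 pv_neq. Qed.

Lemma sqint0 : sqint 0 = 0.
Proof. by rewrite /sqint !expr0 invr1 subrr mul0r. Qed.

Lemma geom_sum_pos n : geom_sum (p * v ^+ 2) n.+1 = v ^+ n * sqint n.+1.
Proof.
rewrite /sqint mulrA; apply: (canRL (mulfK den_neq0)).
elim: n => [|n IH].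
  by rewrite /geom_sum big_ord1 !expr0 !expr1 !mul1r.
rewrite geom_sumS mulrDl -mulrA IH mul1r !exprMn !exprS.
have := expf_neq0 n v_neq0; move: (v ^+ n) (p ^+ n) => x y x0.
by case: p_cases => ->; field; rewrite x0.
Qed.

Lemma geom_sum_neg n : geom_sum (p / v ^+ 2) n.+1 = (p * v) ^- n * sqint n.+1.
Proof.
rewrite /sqint mulrA; apply: (canRL (mulfK den_neq0)).
elim: n => [|n IH].
  by rewrite /geom_sum big_ord1 !expr0 invr1 !expr1 !mul1r.
rewrite geom_sumS mulrDl -mulrA IH mul1r !exprMn !exprS.
have := expf_neq0 n v_neq0; move: (v ^+ n) => x x0.
by case: (pow_cases n) => ->; case: p_cases => ->; field;
  rewrite ?x0 ?v_neq0 ?oppr_eq0 ?oner_eq0.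
Qed.

Let p_half (M r m : nat) : p ^+ M = 1 -> M = (r + m)%N -> p ^+ r = p ^+ m.
Proof.
move=> + Mrm; rewrite {}Mrm exprD.
by case: (pow_cases r) => ->; case: (pow_cases m) => -> // /esym; rewrite ?mul1r ?mulr1.
Qed.

Section Telescope.
Variables (M : nat) (g : nat -> K).
Local Notation N := M.+1.
Hypothesis p_M : p ^+ M = 1.
Hypothesis g_rec : forall t, (t < N)%N ->
  g t.+1 * sqint t.+1 = - p ^+ t * sqint (N - t) * g t.

(** The partial sum up to the index [m] is the term of index [m] multiplied by
    [w m * sqint (N - m) / sqint N]; for [m = N] this is zero since
    [sqint 0 = 0].  The hypothesis on [w] is exactly the induction step. *)
Let telescope (z : K) (w : nat -> K) : w 0%N = 1 ->
    (forall m, (m < N)%N ->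
      z * sqint N - p ^+ m * w m * sqint m.+1 = z * w m.+1 * sqint (N - m.+1)) ->
  \sum_(t < N.+1) g t * z ^+ t = 0.
Proof.
move=> w0 wS.
suff E m : (m <= N)%N ->
    sqint N * \sum_(t < m.+1) g t * z ^+ t = g m * z ^+ m * w m * sqint (N - m).
  apply: (mulfI (sqint_neq0 (ltn0Sn M))).
  by rewrite mulr0 (E N (leqnn _)) subnn sqint0 mulr0.
elim: m => [|m IH] mN.
  by rewrite big_ord1 w0 subn0; ring.
rewrite big_ord_recr /= mulrDr IH; last exact: ltnW.
have gm : g m * sqint (N - m) = - p ^+ m * (g m.+1 * sqint m.+1).
  by rewrite g_rec //; case: (pow_cases m) => ->; ring.
have -> : g m * z ^+ m * w m * sqint (N - m) = z ^+ m * w m * (g m * sqint (N - m)).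
  by ring.
have -> : g m.+1 * z ^+ m.+1 * w m.+1 * sqint (N - m.+1)
    = g m.+1 * z ^+ m * (z * w m.+1 * sqint (N - m.+1)).
  by rewrite exprS; ring.
by rewrite gm -wS // exprS; ring.
Qed.

(** In this lemma and the next, [g t] is (-1)^t p^binom(t,2) times the super
    binomial coefficient of [N] and [t], known only through its recurrence.
    These are the vanishing values of the q-binomial theorem: the product
    of the factors 1 - z (p v^2)^j for j < N has a factor equal to zero when
    z is 1 or (p v^2)^(1-N). *)
Lemma binomial_sum_neg : \sum_(t < N.+1) g t * (v ^- M) ^+ t = 0.
Proof.
apply: (telescope (w := fun m => v ^- m)) => [|m mN]; first by rewrite expr0 invr1.
have [r Mrm] : exists r, M = (r + m)%N by exists (M - m)%N; rewrite subnK.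
have pr := p_half p_M Mrm; rewrite Mrm subSS addnK.
apply: (mulIf den_neq0); rewrite mulrBl -!mulrA !(mulVf den_neq0) !mulr1.
rewrite !exprMn !exprS !exprD pr.
have := expf_neq0 m v_neq0; have := expf_neq0 r v_neq0.
move: (v ^+ m) (v ^+ r) => x y x0 y0.
by case: (pow_cases m) => ->; case: p_cases => ->; field;
  rewrite ?x0 ?y0 ?v_neq0 ?oppr_eq0 ?oner_eq0.
Qed.

Lemma binomial_sum_pos : \sum_(t < N.+1) g t / (v ^- M) ^+ t = 0.
Proof.
under eq_bigr => t _ do rewrite -exprVn invrK.
apply: (telescope (w := fun m => (p * v) ^+ m)) => [|m mN]; first by rewrite expr0.
have [r Mrm] : exists r, M = (r + m)%N by exists (M - m)%N; rewrite subnK.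
have pr := p_half p_M Mrm; rewrite Mrm subSS addnK.
apply: (mulIf den_neq0); rewrite mulrBl -!mulrA !(mulVf den_neq0) !mulr1.
rewrite !exprMn !exprS !exprD pr.
have := expf_neq0 m v_neq0; have := expf_neq0 r v_neq0.
move: (v ^+ m) (v ^+ r) => x y x0 y0.
by case: (pow_cases m) => ->; case: p_cases => ->; field;
  rewrite ?x0 ?y0 ?v_neq0 ?oppr_eq0 ?oner_eq0.
Qed.

End Telescope.

(** The four conditions of the Serre computation, for coefficients [cf] that
    differ from the preceding [g] by powers of the sign [r] of the two letters;
    the weights are v^2 and v^(-M). *)
Section SerreCoefficients.
Variables (M : nat) (r : K) (cf : nat -> K).
Local Notation N := M.+1.
Hypothesis p_M : p ^+ M = 1.
Hypothesis r_sq : r * r = 1.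
Hypothesis cf_rec : forall t, (t < N)%N ->
  cf t.+1 * sqint t.+1 = - (r * p ^+ t) * sqint (N - t) * cf t.

Lemma serre_coef_step_pos t : (t < N)%N ->
  cf t.+1 * geom_sum (p * v ^+ 2) t.+1
  + cf t * p ^+ t * r * v ^- M * (v ^+ 2) ^+ t * geom_sum (p * v ^+ 2) (N - t) = 0.
Proof.
move=> tN; have [m Mtm] : exists m, M = (m + t)%N by exists (M - t)%N; rewrite subnK.
have := cf_rec tN; rewrite (_ : N - t = m.+1)%N; last by rewrite Mtm -addSn addnK.
rewrite !geom_sum_pos Mtm exprD -exprM mulnC exprM.
have := expf_neq0 t v_neq0; have := expf_neq0 m v_neq0.
move: (v ^+ t) (v ^+ m) => x y y0 x0 E.
rewrite (_ : cf t.+1 * _ = x * (cf t.+1 * sqint t.+1)); last by ring.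
by rewrite E; field; rewrite x0 y0.
Qed.

Lemma serre_coef_step_neg t : (t < N)%N ->
  cf t.+1 * geom_sum (p / v ^+ 2) t.+1
  + cf t * p ^+ t * r / v ^- M / (v ^+ 2) ^+ t * geom_sum (p / v ^+ 2) (N - t) = 0.
Proof.
move=> tN; have [m Mtm] : exists m, M = (m + t)%N by exists (M - t)%N; rewrite subnK.
have pm := p_half p_M Mtm.
have := cf_rec tN; rewrite (_ : N - t = m.+1)%N; last by rewrite Mtm -addSn addnK.
rewrite !geom_sum_neg Mtm exprD -exprM mulnC exprM !exprMn pm.
have := expf_neq0 t v_neq0; have := expf_neq0 m v_neq0.
move: (v ^+ t) (v ^+ m) => x y y0 x0 E.
rewrite (_ : cf t.+1 * _ = (p ^+ t * x)^-1 * (cf t.+1 * sqint t.+1)); last by ring.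
rewrite E; case: (pow_cases t) => ->; field; rewrite ?x0 ?y0 ?oppr_eq0 ?oner_eq0 //.
Qed.

Let g_rec t : (t < N)%N ->
  cf t.+1 * r ^+ t.+1 * sqint t.+1 = - p ^+ t * sqint (N - t) * (cf t * r ^+ t).
Proof.
move=> tN; rewrite exprS (_ : _ * sqint t.+1 = r * r ^+ t * (cf t.+1 * sqint t.+1)).
  by rewrite cf_rec //; ring: r_sq.
by ring.
Qed.

Lemma serre_coef_sum_pos : \sum_(t < N.+1) cf t * r ^+ t * (v ^- M) ^+ t = 0.
Proof. exact: (binomial_sum_neg p_M g_rec). Qed.

Lemma serre_coef_sum_neg : \sum_(t < N.+1) cf t * r ^+ t / (v ^- M) ^+ t = 0.
Proof. exact: (binomial_sum_pos p_M g_rec). Qed.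

End SerreCoefficients.

End SuperQuantumIntegers.

(** * The Borcherds-Bozec superalgebra *)

(** The quotient by the relations [S] is obtained from the quotient by weaker
    relations [R] by dividing out the images of the relators of [S]. *)
Section QuotientTower.
Variables (K : nzRingType) (A : algType K) (R S : relations A).
Hypothesis RS : forall r, R r -> quot_alg_pi S r = 0.

Lemma quot_tower : exists psi : {linear quot_alg R -> quot_alg S},
  [/\ forall f, psi (quot_alg_pi R f) = quot_alg_pi S f,
      psi 1 = 1,
      forall u v, psi (u * v) = psi u * psi v,
      forall u, exists t, u = psi t
    & forall (V : lmodType K) (f : {linear quot_alg R -> V}),
        (forall u s v, S s -> f (u * quot_alg_pi R s * v) = 0) ->
        exists g : {linear quot_alg S -> V}, forall u, g (psi u) = f u].
Proof.
have [|psi psiE] := @quot_lift _ _ _ (two_sided R) (quot_alg_pi S).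
  by move=> _ [u [r [v [/RS r0 ->]]]]; rewrite !rmorphM /= r0 mulr0 mul0r.
have onto (T : relations A) (u : quot_alg T) : exists f, u = quot_alg_pi T f.
  by exists (quot_repr u); rewrite [RHS]quot_reprK.
exists psi; split=> //.
- by rewrite -(rmorph1 (quot_alg_pi R)) [LHS]psiE rmorph1.
- move=> u v; have [[f ->] [g ->]] := (onto _ u, onto _ v).
  by rewrite -rmorphM [LHS]psiE rmorphM; congr (_ * _); apply/esym/psiE.
- by move=> u; have [f ->] := onto _ u; exists (quot_alg_pi R f); rewrite [RHS]psiE.
move=> V f f0.
have [|g gE] := @quot_lift _ _ _ (two_sided S) (f \o quot_alg_pi R)%FUN.
  by move=> _ [u [s [v [Ss ->]]]] /=; rewrite !rmorphM f0.
exists g => u; have [h ->] := onto _ u.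
by rewrite [psi _]psiE [LHS]gE.
Qed.

End QuotientTower.

Section BorcherdsBozec.
Variable D : superdatum.
Local Notation q := (q : Qq).
Local Notation I := (Iinf D).
Local Notation H := (dual (lattice D)).
Local Notation F := (free_alg Qq (gen D)).

Lemma q_pow_neq1 n : (0 < n)%N -> q ^+ n != 1.
Proof.
move=> n0; rewrite /Defs.q -tofracXn -(tofrac1 {poly rat}) tofrac_eq.
apply/eqP => /(congr1 (fun r : {poly rat} => size r)).
by rewrite size_polyXn size_poly1; case: n n0.
Qed.

Lemma q_neq0 : q != 0.
Proof. by rewrite /Defs.q tofrac_eq0 polyX_eq0. Qed.

Lemma qi_neq0 (i : vertex D) : q_ i != 0.
Proof. by rewrite expf_neq0 ?q_neq0. Qed.

Lemma qi_generic (i : vertex D) n : (0 < n)%N -> q_ i ^+ n != 1.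
Proof. by move=> n0; rewrite /q_ -exprM q_pow_neq1 // muln_gt0 dsym_gt0. Qed.

Definition q_weight (h : H) (x : I) : Qq := q ^ ((level x)%:Z * ⟨h, alpha (vert x)⟩).
Definition super_sign (x y : I) : Qq := (-1) ^+ (level_parity x * level_parity y).
Definition K_exponent (x : I) : H := coroot (vert x) *~ ((level x)%:Z * (dsym (vert x))%:Z).
Definition cross_coef (x : I) : Qq :=
  (1 - (-1) ^+ level_parity x * q_ (vert x) ^+ (2 * level x))^-1.

Lemma pairing_mulz (g : H) n (x : lattice D) : ⟨g *~ n, x⟩ = n * ⟨g, x⟩.
Proof.
have pairingD (h h' : H) : ⟨h + h', x⟩ = ⟨h, x⟩ + ⟨h', x⟩ by [].
have pairing0 : ⟨(0 : H), x⟩ = 0 by [].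
have pairingN (h : H) : ⟨- h, x⟩ = - ⟨h, x⟩ by [].
have pairingMn m : ⟨g *+ m, x⟩ = m%:Z * ⟨g, x⟩.
  elim: m => [|m IH]; first by rewrite mulr0n mul0r.
  by rewrite mulrS pairingD IH intS mulrDl mul1r.
case: n => n; first exact: pairingMn.
by rewrite NegzE mulrNz pairingN mulNr; congr (- _); apply: pairingMn.
Qed.

Fact q_weight0 (x : I) : q_weight 0 x = 1.
Proof. by rewrite /q_weight [pairing _ _](_ : _ = 0) // mulr0 expr0z. Qed.
Fact q_weightD g h x : q_weight (g + h) x = q_weight g x * q_weight h x.
Proof. by rewrite /q_weight -expfzDr ?q_neq0 // -mulrDr. Qed.
Fact super_sign_sym (x y : I) : super_sign x y = super_sign y x.
Proof. by rewrite /super_sign mulnC. Qed.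
Fact super_sign_sq (x y : I) : super_sign x y * super_sign x y = 1.
Proof. by rewrite -exprD addnn -mul2n exprM sqrrN !expr1n. Qed.

Definition bb_datum : crossing_datum Qq :=
  CrossingDatum K_exponent q_weight0 q_weightD super_sign_sym super_sign_sq.

Lemma q_weight_K (x y : I) : q_weight (K_exponent x) y
  = q ^ ((level y)%:Z * (level x)%:Z * ((dsym (vert x))%:Z * cartan (vert x) (vert y))).
Proof. by rewrite /q_weight pairing_mulz pairing_alpha !mulrA. Qed.

Lemma q_weight_K_sym (x y : I) : q_weight (K_exponent x) y = q_weight (K_exponent y) x.
Proof. by rewrite !q_weight_K cartan_symmetrizable [_%:Z * _]mulrC. Qed.

Lemma level_real (x : I) : real_vertex (vert x) -> level x = 1%N.
Proof.
move=> x_real; case: x x_real => [[i l] /= il]; rewrite /vert /level /= => x_real.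
have := il; rewrite x_real /imag_vertex (eqP x_real) /= orbF.
by move/eqP.
Qed.

Lemma super_sign_level1 (x : I) : level x = 1%N -> super_sign x x = (-1) ^+ parity (vert x).
Proof.
move=> x1; rewrite /super_sign /level_parity x1 mul1n /parity.
by case: odd_vertex.
Qed.

Lemma qbin_rec (i : vertex D) N t : (t < N)%N ->
  qbin i N t.+1 * qint i t.+1 = qint i (N - t) * qbin i N t.
Proof.
move=> tN.
have pp : (-1) ^+ parity i * (-1) ^+ parity i = 1 :> Qq.
  by rewrite -exprD addnn -mul2n exprM sqrrN !expr1n.
have nz n : (0 < n)%N -> qint i n != 0.
  exact: (sqint_neq0 pp (qi_neq0 i) (@qi_generic i)).
have fS n : qfact i n.+1 = qfact i n * qint i n.+1 by rewrite /qfact big_nat_recr.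
have fnz n : qfact i n != 0.
  elim: n => [|n IH]; first by rewrite /qfact big_geq // oner_eq0.
  rewrite (fS n); exact: (mulf_neq0 IH (nz n.+1 isT)).
rewrite /qbin; have -> : (N - t = (N - t.+1).+1)%N by rewrite subnSK.
move: (N - t.+1)%N => m; rewrite (fS t) (fS m).
have := fnz t; have := fnz m; have := nz t.+1 isT; have := nz m.+1 isT.
move: (qfact i t) (qfact i m) (qfact i N) (qint i t.+1) (qint i m.+1).
move: Qq => K a b e g h h0 g0 b0 a0.
by field; rewrite a0 b0 g0 h0.
Qed.

Section Serre.
Variables x y : I.
Hypothesis x_real : real_vertex (vert x).
Hypothesis xy : x != y.
Let i := vert x.
Let p : Qq := (-1) ^+ parity i.

Definition serre_coef t : Qq :=
  (-1) ^+ t * (-1) ^+ (parity (vert x) * (t * level_parity y + 'C(t, 2)))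
  * qbin (vert x) (serre_deg x y) t.

Let M : nat := absz ((level y)%:Z * cartan (vert x) (vert y)).

Let off_diag : vert x != vert y.
Proof.
apply: contra xy => /eqP ij; apply/eqP/val_inj.
have lx := level_real x_real; have ly : level y = 1%N by rewrite level_real // -ij.
rewrite [val x]surjective_pairing [val y]surjective_pairing.
by congr (_, _); rewrite ?[_.2]lx ?[_.2]ly.
Qed.

Let M_def : (level y)%:Z * cartan (vert x) (vert y) = - M%:Z.
Proof.
rewrite /M abszE ler0_norm ?opprK //.
by rewrite mulr_ge0_le0 // cartan_off_diag.
Qed.

Let serre_degE : serre_deg x y = M.+1.
Proof. by rewrite /serre_deg M_def opprK. Qed.

Let pp : p * p = 1.
Proof. by rewrite -exprD addnn -mul2n exprM sqrrN !expr1n. Qed.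

(** For odd i the entries a_ij are even; the signs in the Serre coefficients
    match only because of this. *)
Let p_M : p ^+ M = 1.
Proof.
rewrite /p /parity; case: (boolP (odd_vertex i)) => [oi|_]; last by rewrite expr1n.
have : (2 %| (level y)%:Z * cartan (vert x) (vert y))%Z.
  by rewrite dvdz_mull // cartan_odd.
rewrite expr1 M_def dvdzE abszN /= => /dvdnP [m ->].
by rewrite mulnC exprM sqrrN !expr1n.
Qed.

Let sgnE : super_sign x x = p.
Proof. exact/super_sign_level1/level_real. Qed.

Let wt_xx : q_weight (K_exponent x) x = q_ i ^+ 2.
Proof.
rewrite q_weight_K (level_real x_real) !mul1r; move: x_real; rewrite /real_vertex => /eqP ->.
by rewrite -exprz_exp.
Qed.

Let wt_xy : q_weight (K_exponent x) y = q_ i ^- M.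
Proof.
rewrite q_weight_K (level_real x_real) mulr1 mulrCA M_def -exprz_exp.
by rewrite -exprnN.
Qed.

Let coef_rec t : (t < M.+1)%N -> serre_coef t.+1 * qint i t.+1
  = - (super_sign x y * p ^+ t) * qint i (M.+1 - t) * serre_coef t.
Proof.
rewrite -serre_degE => tN.
have -> : super_sign x y = (-1) ^+ (parity i * level_parity y).
  rewrite /super_sign {1}/level_parity (level_real x_real) mul1n /parity.
  by case: odd_vertex.
rewrite /serre_coef -[LHS]mulrA (qbin_rec _ tN).
set e := parity (vert x); set f := level_parity y.
have -> : (e * (t.+1 * f + 'C(t.+1, 2)) = e * f + e * t + e * (t * f + 'C(t, 2)))%N.
  by rewrite binS bin1 mulSn -!mulnDr [('C(t, 2) + t)%N]addnC addnACA.
rewrite /p -exprM !exprD exprS mulN1r.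
move: (qint _ _) (qbin _ _ _) ((-1) ^+ t) ((-1) ^+ (e * f)) => u w z z1.
move: ((-1) ^+ (e * t)) ((-1) ^+ (e * (t * f + 'C(t, 2)))) => z2 z3.
by move: Qq u w z z1 z2 z3 => K *; ring.
Qed.

(** The weights are Q = q_i^2 and Y = Z = q_i^(-M) with M = - k a_ij; here Y
    and Z agree because d_i a_ij = d_j a_ji. *)
Lemma serre_qcomm c (A : algType Qq) (a b : I -> A) (k : H -> A) :
    crossing (D := bb_datum) c a b k ->
  (forall z, qcomm (serre_sum (D := bb_datum) a x y (serre_deg x y) serre_coef) (b z)) /\
  (forall h, qcomm (serre_sum (D := bb_datum) a x y (serre_deg x y) serre_coef) (k h)).
Proof.
move=> rels; split; last exact: (serre_torus rels).
have gen := @qi_generic i; have v0 := qi_neq0 i.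
have rr : super_sign x y * super_sign x y = 1 by exact: super_sign_sq.
have Es : sign (c := bb_datum) x x = p := sgnE.
have Ex : weight (c := bb_datum) (kappa (c := bb_datum) x) x = q_ i ^+ 2 := wt_xx.
have Exy : weight (c := bb_datum) (kappa (c := bb_datum) x) y = q_ i ^- M := wt_xy.
have Eyx : weight (c := bb_datum) (kappa (c := bb_datum) y) x = q_ i ^- M.
  by rewrite -Exy; exact: q_weight_K_sym.
rewrite serre_degE.
apply: (serre_b rels xy); rewrite ?Es ?Ex ?Exy ?Eyx.
- move=> t tN; exact: (serre_coef_step_pos pp v0 gen coef_rec tN).
- move=> t tN; exact: (serre_coef_step_neg pp v0 gen p_M coef_rec tN).
- exact: (serre_coef_sum_pos pp v0 gen p_M rr coef_rec).
- exact: (serre_coef_sum_neg pp v0 gen p_M rr coef_rec).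
Qed.

End Serre.

End BorcherdsBozec.

Section QuotientRelations.
Variables (K : nzRingType) (A : algType K) (R : relations A).
Local Notation pi := (quot_alg_pi R).

Let piM x y : pi (x * y) = pi x * pi y. Proof. exact: rmorphM. Qed.
Let piZ d x : pi (d *: x) = d *: pi x. Proof. exact: linearZ. Qed.

Lemma quot_alg_pi_sub x y : pi (x - y) = 0 <-> pi x = pi y.
Proof.
rewrite rmorphB; split=> [/eqP|/eqP xy]; first by rewrite subr_eq0 => /eqP.
by apply/eqP; rewrite subr_eq0.
Qed.

Lemma relation_of_conj k k' a w : pi (k' * k) = 1 ->
  pi (k * a * k' - w *: a) = 0 -> pi (k * a - w *: (a * k)) = 0.
Proof.
move=> k'k /quot_alg_pi_sub kak; apply/quot_alg_pi_sub.
transitivity (pi (k * a * k') * pi k).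
  by rewrite -piM -[k * a * k' * k]mulrA [in RHS]piM k'k mulr1.
by rewrite kak -piM -scalerAl.
Qed.

Lemma conj_of_relation k k' a w : pi (k * k') = 1 ->
  pi (k * a - w *: (a * k)) = 0 -> pi (k * a * k' - w *: a) = 0.
Proof.
move=> kk' /quot_alg_pi_sub ka; apply/quot_alg_pi_sub.
by rewrite piM ka -piM -scalerAl -mulrA !piZ piM kk' mulr1.
Qed.

Lemma quot_alg_pi_unit (H : zmodType) (k : H -> A) h :
    pi (k 0 - 1) = 0 -> (forall g h, pi (k (g + h) - k g * k h) = 0) ->
  pi (k h * k (- h)) = 1 /\ pi (k (- h) * k h) = 1.
Proof.
move=> /quot_alg_pi_sub; rewrite rmorph1 => k0 kD.
have kDE g h' := proj1 (quot_alg_pi_sub _ _) (kD g h').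
by split; rewrite -kDE ?subrr ?addNr.
Qed.

End QuotientRelations.

Lemma serre_morph (K : fieldType) (D : crossing_datum K) (A B : algType K)
    (f : {lrmorphism A -> B}) (g : letter D -> A) x y N (cf : nat -> K) :
  f (serre_sum g x y N cf) = serre_sum (fun z => f (g z)) x y N cf.
Proof.
rewrite /serre_sum raddf_sum; apply: eq_bigr => t _ /=.
by rewrite linearZ /= !rmorphM /= !rmorphXn.
Qed.

Lemma supercomm_morph (K : nzRingType) (A B : algType K) (f : {lrmorphism A -> B})
    (d : K) (u v : A) : f (u * v - d *: (v * u)) = f u * f v - d *: (f v * f u).
Proof. by rewrite rmorphB /= linearZ /= !rmorphM. Qed.

Local Notation U_rels D := (Relations (@relator_U_proper D)).
Local Notation cross_rels D :=
  (Relations (@cross_relator_proper Qq (bb_datum D) (@cross_coef D))).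

Section Instance.
Variable D : superdatum.
Local Notation I := (Iinf D).
Local Notation H := (dual (lattice D)).
Local Notation F := (free_alg Qq (gen D)).
Local Notation pi := (quot_alg_pi (U_rels D)).
Local Notation tpi := (quot_alg_pi (cross_rels D)).

Lemma subr_sub (V : zmodType) (x y z : V) : x - y - z = x - (y + z).
Proof. by rewrite opprD addrA. Qed.

Lemma gen_KE (x : I) :
  gen_K (vert x) (level x)%:Z = gen_q (K_exponent x) /\
  gen_K (vert x) (- (level x)%:Z) = gen_q (- K_exponent x).
Proof. by rewrite /gen_K mulNr mulrNz. Qed.

Lemma cross_relator_U r : @cross_relator Qq (bb_datum D) (@cross_coef D) r -> pi r = 0.
Proof.
have rel s : relator_U s -> pi s = 0 by exact: (@quot_alg_pi0 _ _ (U_rels D)).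
have k0 := rel _ (rel_q0 D); have kD g h := rel _ (rel_qD g h).
have k1 h := quot_alg_pi_unit h k0 kD.
case=> [|g h|h x|h x|x y].
- exact: k0.
- exact: kD.
- exact: (relation_of_conj (proj2 (k1 h)) (rel _ (rel_qa h x))).
- have -> : weight (c := bb_datum D) (- h) x
      = Defs.q ^ (- ((level x)%:Z * ⟨h, alpha (vert x)⟩)).
    by rewrite -mulrN.
  exact: (relation_of_conj (proj2 (k1 h)) (rel _ (rel_qb h x))).
have := rel _ (rel_ab x y).
rewrite /supercomm subr_sub (proj1 (gen_KE x)) (proj2 (gen_KE x)).
exact.
Qed.

Let X_cross : @crossing Qq (bb_datum D) (@cross_coef D) (quot_alg (cross_rels D))
  (fun x => tpi (gen_a x)) (fun x => tpi (gen_b x)) (fun h => tpi (gen_q h)).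
Proof. exact: cross_alg_crossing. Qed.
Let X_swap := crossing_swap X_cross.

Lemma q_weight_K_eq1 (x y : I) : cartan (vert x) (vert y) = 0 ->
  q_weight (K_exponent x) y = 1 /\ q_weight (K_exponent y) x = 1.
Proof.
move=> xy; have w : q_weight (K_exponent x) y = 1 by rewrite q_weight_K xy !mulr0 expr0z.
by split=> //; rewrite q_weight_K_sym.
Qed.

Let kN (g : H -> quot_alg (cross_rels D)) (S : quot_alg (cross_rels D)) :
  (forall h, qcomm S (g (- h))) -> forall h, qcomm S (g h).
Proof. by move=> gN h; rewrite -[h]opprK. Qed.

Let serre_gen (g : I -> F) x y :
  tpi (serre g x y)
  = serre_sum (D := bb_datum D) (fun z => tpi (g z)) x y (serre_deg x y) (serre_coef x y).
Proof. exact: (@serre_morph Qq (bb_datum D) F (quot_alg (cross_rels D)) tpi g x y). Qed.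

Let serre_mem (A : algType Qq) (g : I -> A) x y N cf :
  gen_subalg (fun u => exists z, u = g z) (serre_sum (D := bb_datum D) g x y N cf).
Proof.
have mem z : g z \in gen_subalgb (fun u => exists z, u = g z).
  by apply/gen_subalgP/gen_subalg_mem; exists z.
apply/gen_subalgP; rewrite rpred_sum // => t _.
by rewrite rpredZ // !rpredM // rpredX.
Qed.

Let comm_mem (A : algType Qq) (g : I -> A) x y (d : Qq) :
  gen_subalg (fun u => exists z, u = g z) (g x * g y - d *: (g y * g x)).
Proof.
have mem z : g z \in gen_subalgb (fun u => exists z, u = g z).
  by apply/gen_subalgP/gen_subalg_mem; exists z.
by apply/gen_subalgP; rewrite rpredB ?rpredZ // rpredM.
Qed.

Let comm_gen (g : I -> F) x y :
  tpi (supercomm x y (g x) (g y))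
  = tpi (g x) * tpi (g y) - super_sign x y *: (tpi (g y) * tpi (g x)).
Proof. exact: (supercomm_morph tpi). Qed.

(** The relators of [U] that do not hold already in [cross_alg] are those among
    the [a]s and those among the [b]s; the latter are handled by exchanging the
    two kinds of letters, with q^h replaced by q^(-h). *)
Lemma relator_U_cases r : relator_U r ->
  [\/ tpi r = 0,
      [/\ gen_subalg (fun u => exists x, u = tpi (gen_a x)) (tpi r),
          forall z, qcomm (tpi r) (tpi (gen_b z))
        & forall h, qcomm (tpi r) (tpi (gen_q h))]
    | [/\ gen_subalg (fun u => exists x, u = tpi (gen_b x)) (tpi r),
          forall z, qcomm (tpi r) (tpi (gen_a z))
        & forall h, qcomm (tpi r) (tpi (gen_q h))]].
Proof.
have rel s : @cross_relator Qq (bb_datum D) (@cross_coef D) s -> tpi s = 0.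
  exact: (@quot_alg_pi0 _ _ (cross_rels D)).
have k0 := rel _ (@cross_k0 _ (bb_datum D) _).
have kD g h := rel _ (@cross_kD _ (bb_datum D) _ g h).
have k1 h := quot_alg_pi_unit h k0 kD.
case=> [|g h|h x|h x|x y x_real xy|x y x_real xy|x y a0|x y a0|x y].
- by apply: Or31; exact: k0.
- by apply: Or31; exact: kD.
- apply: Or31.
  exact: (conj_of_relation (proj1 (k1 h)) (rel _ (@cross_ka _ (bb_datum D) _ h x))).
- apply: Or31.
  have -> : Defs.q ^ (- ((level x)%:Z * ⟨h, alpha (vert x)⟩))
      = weight (c := bb_datum D) (- h) x.
    by rewrite -mulrN.
  exact: (conj_of_relation (proj1 (k1 h)) (rel _ (@cross_kb _ (bb_datum D) _ h x))).
- apply: Or32; rewrite serre_gen.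
  by have [Sb Sk] := serre_qcomm x_real xy X_cross; split; first exact: serre_mem.
- apply: Or33; rewrite serre_gen.
  have [Sa Sk] := serre_qcomm x_real xy X_swap; split; first exact: serre_mem.
    exact: Sa.
  exact: (kN Sk).
- have [w1 w2] := q_weight_K_eq1 a0.
  apply: Or32; rewrite comm_gen; split; first exact: comm_mem.
    exact: (supercomm_qcomm X_cross w1 w2).
  exact: (supercomm_torus X_cross x y).
- have [w1 w2] := q_weight_K_eq1 a0.
  apply: Or33; rewrite comm_gen; split; first exact: comm_mem.
    exact: (supercomm_qcomm X_swap w1 w2).
  exact: (kN (supercomm_torus X_swap x y)).
- apply: Or31; have := rel _ (@cross_a_b _ (bb_datum D) _ x y).
  rewrite /supercomm subr_sub (proj1 (gen_KE x)) (proj2 (gen_KE x)).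
  exact.
Qed.

End Instance.

Theorem theorem3p2 (D : superdatum) :
  exists m : {linear (Uminus D ⊗ Uzero D ⊗ Uplus D)%type -> U D},
    (forall (x : Uminus D) (y : Uzero D) (z : Uplus D),
       m (x ⊗ y ⊗ z)%tensor = val x * val y * val z) /\
    bijective m.
Proof.
have [psi [psiE psi1 psiM psi_onto psi_lift]] :=
  @quot_tower Qq (free_alg Qq (gen D)) (cross_rels D) (U_rels D) (@cross_relator_U D).
pose tpi := quot_alg_pi (cross_rels D).
pose Rt S := exists2 r, relator_U r & S = tpi r.
apply: (@triangular_decomposition Qq (bb_datum D) (@cross_coef D) (quot_alg (cross_rels D))
  (fun x => tpi (gen_a x)) (fun x => tpi (gen_b x)) (fun h => tpi (gen_q h))
  _ _ Rt _ (U D) (@Ua D) (@Ub D) (@Uq D) _ psi).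
- move=> u; apply: (@free_quot_span Qq (bb_datum D) (@cross_coef D) (cross_rels D)).
  exact: (@quot_alg_pi0 _ _ (cross_rels D)).
- move=> V f; have [phi phiE] := @cross_normal_form Qq (bb_datum D) (@cross_coef D).
  exists (malg_ext (fun m : seq (Iinf D) * dual (lattice D) * seq (Iinf D) =>
    f m.1.1 m.1.2 m.2) \o phi)%FUN.
  by move=> v h w; rewrite /= [phi _]phiE malg_extU.
- by move=> _ [r Rr ->]; apply: relator_U_cases.
- exact: (@quot_alg_crossing Qq (bb_datum D) (@cross_coef D) (U_rels D) (@cross_relator_U D)).
- exact: psi1.
- exact: psiM.
- by move=> x; apply: psiE.
- by move=> x; apply: psiE.
- by move=> x; apply: psiE.
- exact: psi_onto.
- by move=> _ [r Rr ->]; rewrite [LHS]psiE; apply: quot_alg_pi0.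
- move=> V f f0; apply: psi_lift => u s v Rs; apply: f0.
  by exists s.
Qed.
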